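(* For every integer $n\ge 1$ and every ordinal $\gamma$, the inverse system $\mathbf d_n\mathbf P_n(\gamma)$ is free if and only if there exists an $n$-dimensional tail-acyclic simplicial complex on $\gamma$.
   Context: For a set $A$ of ordinals and $n\ge 0$, $P_n(A)$ is the free abelian group with generators $\langle\vec\alpha\rangle$, $\vec\alpha\in[A]^{n+1}$ (strictly increasing tuples). For $n\ge1$, $d_n:P_n(A)\to P_{n-1}(A)$ is $\langle\vec\alpha\rangle\mapsto\sum_{i=0}^n(-1)^i\langle\vec\alpha^i\rangle$, $\vec\alpha^i$ being $\vec\alpha$ with its $i$-th coordinate (from $0$) removed. An inverse system indexed by an ordinal $\gamma$ is $\mathbf X=(X_\alpha,x_{\alpha\beta},\gamma)$ with groups $X_\alpha$ and compatible homomorphisms $x_{\alpha\beta}:X_\beta\to X_\alpha$ for $\alpha\le\beta<\gamma$. $\mathbf d_n\mathbf P_n(\gamma)$ is the system whose term at $\alpha<\gamma$ is the subgroup $d_n(P_n([\alpha,\gamma)))$ of $P_{n-1}([\alpha,\gamma))$, with inclusion bonding maps. A system $\mathbf X$ is free if there is $\mathcal B\subseteq\bigcup_\alpha X_\alpha$ such that every $x\in X_\alpha$ has a unique decomposition $x=\sum_{i<k}a_i x_{\alpha\beta_i}(b_i)$ with $\alpha\le\beta_i$, distinct $b_i\in X_{\beta_i}\cap\mathcal B$ and nonzero integers $a_i$. A simplicial complex on $\gamma$ is a family of nonempty finite subsets of $\gamma$ closed under nonempty subsets; $B^k$ denotes its set of $(k+1)$-element members ($k$-faces), its dimension is $\sup\{k:B^k\ne\varnothing\}$.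 Reduced simplicial homology $\tilde{\mathrm H}^\Delta_k$ is computed from the chain groups $C_k(B)=\bigoplus_{B^k}\mathbb Z$ with boundary $\partial_k\langle\vec\alpha\rangle=\sum_i(-1)^i\langle\vec\alpha^i\rangle$ (faces written as increasing tuples), $C_{-1}=\mathbb Z$, $\partial_0\langle\alpha\rangle=1$. $B|_X$ is the subcomplex of faces contained in $X$. An $n$-dimensional complex $G$ on $\gamma$ is tail-acyclic if $G^{n-1}=[\gamma]^n$ and $\tilde{\mathrm H}^\Delta_k(G|_{[\alpha,\gamma)})=0$ for all $\alpha<\gamma$ and $k\ge0$.
   Formalization: When γ has at most n elements no n-face exists although the zero system is free, so the equivalence fails as stated; there ''n-dimensional'' is read as ''of dimension at most n''. For all γ with at least n+1 elements the dimension is exactly n. *)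

(* Defs.v *)
From HB Require Import structures.
From mathcomp Require Import all_boot all_order all_algebra.
From mathcomp Require Import finmap boolp.
From mathcomp Require Import freeg.

Set Implicit Arguments.
Unset Strict Implicit.
Unset Printing Implicit Defensive.

Import Order.TTheory GRing.Theory.

Local Open Scope ring_scope.
Local Open Scope order_scope.
Local Open Scope fset_scope.

(* Ordinals are represented by well-ordered types: an ordinal [gamma] is an
   [orderType] whose strict order is well-founded, and the ordinals
   [alpha < gamma] are its elements. *)
Definition well_ordered (disp : Order.disp_t) (gamma : orderType disp) : Prop :=
  well_founded (fun x y : gamma => x < y).

Section Simplices.
Context (disp : Order.disp_t) (gamma : orderType disp).

(* m counts vertices: the elements of [simplex m] have dimension m - 1. *)
Definition simplex (m : nat) : Type := {t : m.-tuple gamma | sorted <%O t}.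

HB.instance Definition _ m := SubChoice.on (simplex m).

Definition vertices m (s : simplex m) : {fset gamma} :=
  [fset x in tval (val s)].

Fact del_subproof m (s : simplex m.+1) (i : 'I_m.+1) :
  sorted <%O [tuple tnth (val s) (fintype.lift i j) | j < m].
Proof.
have s_lt (a b : 'I_m.+1) : (a < b)%N -> tnth (val s) a < tnth (val s) b.
  move=> ab; have x0 : gamma by exact: (tnth (val s) ord0).
  rewrite !(tnth_nth x0); apply: (sorted_ltn_nth lt_trans) => //.
  - exact: (valP s).
  - by rewrite inE size_tuple ltn_ord.
  - by rewrite inE size_tuple ltn_ord.
rewrite /= sorted_pairwise; last exact: lt_trans.
rewrite pairwise_map -sorted_pairwise; last first.
  by move=> b a c /=; apply: lt_trans.
have : sorted ltn [seq val j | j <- enum 'I_m].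
  by rewrite val_enum_ord iota_ltn_sorted.
rewrite sorted_map; apply: sub_sorted => a b /= ab.
apply: s_lt; rewrite /= /bump.
case: (leqP i a) (leqP i b) => ia [] ib; rewrite ?add0n ?add1n //.
  by move: (leq_trans ia (ltnW ab)); rewrite leqNgt ib.
exact: ltnW.
Qed.

Definition del m (s : simplex m.+1) (i : 'I_m.+1) : simplex m :=
  exist (fun t : m.-tuple gamma => sorted <%O t) _ (del_subproof s i).

End Simplices.

(* [chain n.+1] is P_n(gamma), and [bd n] below is d_n : P_n -> P_(n-1).
   [chain 0] is free on the empty tuple, i.e. the group Z in degree -1, and
   [bd 0] sends every vertex to its generator, i.e. is the augmentation. *)
Notation chain gamma m := {freeg (simplex gamma m) / int}.

Section Chains.
Context (disp : Order.disp_t) (gamma : orderType disp).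

Definition bd m : chain gamma m.+1 -> chain gamma m :=
  fglift (fun s : simplex gamma m.+1 =>
    \sum_(i < m.+1) << (-1) ^+ i *g del s i >> : chain gamma m).

Fact bd_is_additive m : zmod_morphism (@bd m).
Proof. exact: lift_is_additive. Qed.

HB.instance Definition _ m :=
  GRing.isZmodMorphism.Build (chain gamma m.+1) (chain gamma m) (@bd m)
    (@bd_is_additive m).

(* For A a subset of gamma, P_n(A) is identified with the subgroup of P_n(gamma)
   of the chains supported on tuples of elements of A. *)
Definition chain_on m (A : {pred gamma}) (c : chain gamma m) : Prop :=
  forall s, s \in dom c -> {subset tval (val s) <= A}.

Definition tail (a : gamma) : {pred gamma} := [pred x | a <= x].

End Chains.

Record inverse_system (disp : Order.disp_t) (gamma : orderType disp) :=
  InverseSystem {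
    term : gamma -> zmodType;
    bond : forall a b : gamma, a <= b -> {additive term b -> term a};
    bond_id : forall (a : gamma) (h : a <= a) (x : term a), bond h x = x;
    bond_comp : forall (a b c : gamma) (hab : a <= b) (hbc : b <= c)
      (hac : a <= c) (x : term c), bond hab (bond hbc x) = bond hac x
  }.

Arguments term {disp gamma} X a : rename.
Arguments bond {disp gamma} X {a b} h : rename.

Section Free.
Context (disp : Order.disp_t) (gamma : orderType disp).
Context (X : inverse_system gamma).

Definition above (a : gamma) : Type :=
  {p : {b : gamma & term X b} | a <= tag p}.

HB.instance Definition _ a := SubChoice.on (above a).

Definition bond_above (a : gamma) (p : above a) : term X a :=
  bond X (valP p) (tagged (val p)).

(* A subset of the (disjoint) union of the X_b is a family [B] of predicates.
   An element [f] of {freeg K / int} is a finite formal sum of distinct keys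
   with nonzero coefficients, up to reordering; its keys are listed by [dom]. *)
Definition decomposition (B : forall b, term X b -> Prop) (a : gamma)
    (x : term X a) (f : {freeg (above a) / int}) : Prop :=
  (forall p, p \in dom f -> B (tag (val p)) (tagged (val p))) /\
  x = \sum_(p <- dom f) bond_above p *~ coeff p f.

Definition free_system : Prop :=
  exists B : forall b, term X b -> Prop,
    forall (a : gamma) (x : term X a), exists! f, decomposition B x f.

End Free.

Section BoundarySystem.
Context (disp : Order.disp_t) (gamma : orderType disp).

Definition dP_pred (n : nat) (a : gamma) : {pred chain gamma n} :=
  fun z => `[< exists2 c : chain gamma n.+1, chain_on (tail a) c & z = bd c >].

Arguments dP_pred : clear implicits.

Fact dP_pred_zmod n a : zmod_closed (dP_pred n a).
Proof.
split=> [|_ _ /asboolP[c1 c1P ->] /asboolP[c2 c2P ->]]; apply/asboolP.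
  exists 0; last by rewrite raddf0.
  by move=> s; rewrite dom0.
exists (c1 - c2); last by rewrite raddfB.
by move=> s /domB; rewrite mem_cat => /orP[/c1P|/c2P].
Qed.

Fact dP_pred_le n (a b : gamma) (z : chain gamma n) :
  a <= b -> z \in dP_pred n b -> z \in dP_pred n a.
Proof.
move=> ab /asboolP[c cP ->]; apply/asboolP; exists c => // s /cP sP x /sP.
exact: le_trans.
Qed.

HB.instance Definition _ n a :=
  GRing.isZmodClosed.Build (chain gamma n) (dP_pred n a) (@dP_pred_zmod n a).

Definition dP_term (n : nat) (a : gamma) : Type :=
  {z : chain gamma n | z \in dP_pred n a}.

HB.instance Definition _ n a := SubChoice.on (dP_term n a).
HB.instance Definition _ n a := [SubChoice_isSubZmodule of dP_term n a by <:].

Definition dP_incl (n : nat) (a b : gamma) (h : a <= b) (x : dP_term n b) :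
    dP_term n a :=
  exist _ (val x) (dP_pred_le h (valP x)).

Fact dP_incl_is_additive n (a b : gamma) (h : a <= b) :
  zmod_morphism (@dP_incl n a b h).
Proof. by move=> x y; apply: val_inj. Qed.

HB.instance Definition _ n a b h :=
  GRing.isZmodMorphism.Build (dP_term n b) (dP_term n a) (@dP_incl n a b h)
    (@dP_incl_is_additive n a b h).

Fact dP_incl_id n (a : gamma) (h : a <= a) (x : dP_term n a) :
  dP_incl h x = x.
Proof. exact: val_inj. Qed.

Fact dP_incl_comp n (a b c : gamma) (hab : a <= b) (hbc : b <= c)
  (hac : a <= c) (x : dP_term n c) :
  dP_incl hab (dP_incl hbc x) = dP_incl hac x.
Proof. exact: val_inj. Qed.

Definition dP (n : nat) : inverse_system gamma :=
  @InverseSystem disp gamma (fun a => dP_term n a : zmodType)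
    (fun a b h => @dP_incl n a b h : {additive dP_term n b -> dP_term n a})
    (@dP_incl_id n) (@dP_incl_comp n).

End BoundarySystem.

Section Complexes.
Context (disp : Order.disp_t) (gamma : orderType disp).
Implicit Type B : {fset gamma} -> Prop.

Definition simplicial_complex B : Prop :=
  (forall s, B s -> s != fset0) /\
  (forall s t, B s -> t `<=` s -> t != fset0 -> B t).

Definition face B (k : nat) (s : {fset gamma}) : Prop :=
  B s /\ #|` s| = k.+1.

(* sup {k : B^k nonempty} = n. A set of at most n ordinals carries no n-face at
   all, while the system of boundaries is then zero, hence free; on such a
   gamma, and only there, n-dimensional is read as the upper bound alone. *)
Definition n_dimensional B (n : nat) : Prop :=
  (forall k s, face B k s -> (k <= n)%N) /\
  ((exists s : {fset gamma}, #|` s| = n.+1) -> exists s, face B n s).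

Definition restrict B (A : {pred gamma}) : {fset gamma} -> Prop :=
  fun s => B s /\ {subset s <= A}.

(* C_k(B), as a subgroup of C_k of the full simplex on gamma; only degrees
   k >= 0 occur, so the degree -1 part is always all of [chain gamma 0]. *)
Definition chain_in B k (c : chain gamma k.+1) : Prop :=
  forall s, s \in dom c -> B (vertices s).

Definition reduced_homology_vanishes B (k : nat) : Prop :=
  forall z : chain gamma k.+1, chain_in B z -> bd z = 0 ->
    exists2 c : chain gamma k.+2, chain_in B c & bd c = z.

Definition tail_acyclic B (n : nat) : Prop :=
  (forall s, face B n.-1 s <-> #|` s| = n) /\
  forall (a : gamma) (k : nat),
    reduced_homology_vanishes (restrict B (tail a)) k.

End Complexes.

(* Main.v *)
From HB Require Import structures.
From Stdlib Require Import Wellfounded.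
From mathcomp Require Import all_boot all_order all_algebra.
From mathcomp Require Import finmap boolp classical_sets freeg.
Require Import Defs.

Set Implicit Arguments.
Unset Strict Implicit.
Unset Printing Implicit Defensive.

Import Order.TTheory GRing.Theory.

Local Open Scope classical_set_scope.
Local Open Scope ring_scope.
Local Open Scope order_scope.

(** A basis of the system of boundaries yields a splitting of the boundary map:
    the composite of the boundary with a section that preserves all tails. By
    induction on [n], every subset [A] of [gamma] that carries a splitting in
    degree [n] carries an acyclic set of n-faces, that is one whose boundaries
    form a basis of all boundaries on each tail of [A]; adding all smaller
    simplices to it gives a tail-acyclic complex. Conversely, the boundaries of
    the n-faces of a tail-acyclic complex, each placed at its least vertex, form
    a basis of the system.

    To get an acyclic set of (n+1)-faces on [A], it is enough to have a cofinal
    [E] in [A] and, for each [d] in [E], an acyclic set of n-faces on the part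
    of [E] below [d]: insert the vertices of [E] one at a time, coning each [d]
    over that set, and then the other vertices [v] of [A], coning each [v] over
    all the n-faces that contain a chosen element of [E] above [v]. If [A] has
    countable cofinality, take [E] of order type at most omega. Otherwise pass
    to a cofinal [D] of regular order type, on which the splitting survives,
    and let [E] consist of the [d] such that the chains of [D] below [d] are
    closed under the splitting: below such a [d], a splitting in degree n+1
    evaluated on cones with apex [d] yields a splitting in degree n. *)

(** * Free modules *)

Section Supports.
Context (R : nzRingType) (K : choiceType).
Implicit Types (c : {freeg K / R}) (P : set K).

HB.instance Definition _ (M : lmodType R) (f : K -> M) :=
  GRing.isZmodMorphism.Build {freeg K / R} M (fglift f) (lift_is_additive f).

Fact fglift_is_scalable (M : lmodType R) (f : K -> M) : scalable (fglift f).
Proof.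
move=> k; apply: freeg_ind_dom0 => [|a s c _ _ IH] /=.
  by rewrite scaler0 raddf0 scaler0.
have -> : k *: (<< a *g s >> + c) = << k * a *g s >> + k *: c.
  by apply/eqP/freeg_eqP => t; rewrite !(coeffZ, coeffD, coeffU) mulrDr mulrA.
by rewrite !raddfD /= IH !liftU scalerA.
Qed.

HB.instance Definition _ (M : lmodType R) (f : K -> M) :=
  GRing.isScalable.Build R {freeg K / R} M _ (fglift f)
    (fglift_is_scalable f).

Definition supported P c : Prop := forall s, s \in dom c -> P s.

Lemma fgliftU (M : lmodType R) (f : K -> M) s : fglift f << s >> = f s.
Proof. by rewrite liftU scale1r. Qed.

Lemma freegU_scale k s : << k *g s >> = k *: << s >> :> {freeg K / R}.
Proof. by apply/eqP/freeg_eqP => t; rewrite coeffZ !coeffU mul1r. Qed.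

Lemma supported0 P : supported P 0.
Proof. by move=> s; rewrite dom0. Qed.

Lemma supportedU P s : P s -> supported P << s >>.
Proof. by move=> Ps t; rewrite domU1 inE => /eqP->. Qed.

Lemma supportedD P c1 c2 :
  supported P c1 -> supported P c2 -> supported P (c1 + c2).
Proof.
by move=> P1 P2 s /domD_subset; rewrite mem_cat => /orP[/P1|/P2].
Qed.

Lemma supportedZ P k c : supported P c -> supported P (k *: c).
Proof. by move=> Pc s /domZ_subset/Pc. Qed.

Lemma supportedB P c1 c2 :
  supported P c1 -> supported P c2 -> supported P (c1 - c2).
Proof. by move=> P1 P2 s /domB; rewrite mem_cat => /orP[/P1|/P2]. Qed.

Lemma supportedW P Q c : P `<=` Q -> supported P c -> supported Q c.
Proof. by move=> PQ Pc s /Pc /PQ. Qed.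

Lemma supportedI P Q c :
  supported P c -> supported Q c -> supported (P `&` Q) c.
Proof. by move=> Pc Qc s sc; split; [apply: Pc | apply: Qc]. Qed.

Lemma freeg_neq0 c : c <> 0 -> exists s, s \in dom c.
Proof.
move=> c0; case domE: (dom c) => [|s u]; last by exists s; rewrite mem_head.
by case: c0; apply/eqP; rewrite -dom_eq0 domE.
Qed.

Lemma supported_set0 c : supported set0 c -> c = 0.
Proof. by move=> c0; apply: contrapT => /freeg_neq0[s /c0]. Qed.

Lemma supported_ind P (Q : {freeg K / R} -> Prop) :
  Q 0 -> (forall c1 c2, Q c1 -> Q c2 -> Q (c1 + c2)) ->
  (forall k s, P s -> Q (k *: << s >>)) -> forall c, supported P c -> Q c.
Proof.
move=> Q0 QD QU c Pc; rewrite -[c]freeg_sumE big_seq.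
by apply: big_ind => // s /Pc Ps; rewrite freegU_scale; apply: QU.
Qed.

Lemma eq_linear_supported (M : lmodType R)
    (f g : {linear {freeg K / R} -> M}) P :
  (forall s, P s -> f << s >> = g << s >>) ->
  forall c, supported P c -> f c = g c.
Proof.
move=> fg; apply: supported_ind => [|c1 c2 eq1 eq2|k s /fg eq_s].
- by rewrite !linear0.
- by rewrite !linearD eq1 eq2.
- by rewrite !linearZ /= eq_s.
Qed.

Lemma eq_linear (M : lmodType R) (f g : {linear {freeg K / R} -> M}) :
  (forall s, f << s >> = g << s >>) -> f =1 g.
Proof. by move=> fg c; apply: (@eq_linear_supported _ _ _ setT). Qed.

End Supports.

Lemma supported_linear (R : nzRingType) (K L : choiceType) (P : set K)
    (Q : set L) (f : {linear {freeg K / R} -> {freeg L / R}}) c :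
  (forall s, P s -> supported Q (f << s >>)) -> supported P c ->
  supported Q (f c).
Proof.
move=> fP; elim/supported_ind: c / => [|c1 c2 Q1 Q2|k s /fP Qs].
- by rewrite linear0; apply: supported0.
- by rewrite linearD; apply: supportedD.
- by rewrite linearZ /=; apply: supportedZ.
Qed.

Lemma supported_lift (R : nzRingType) (K L : choiceType) (P : set K) (Q : set L)
    (f : K -> {freeg L / R}) c :
  (forall s, P s -> supported Q (f s)) -> supported P c ->
  supported Q (fglift f c).
Proof.
by move=> fP; apply: supported_linear => s Ps; rewrite /= fgliftU; apply: fP.
Qed.

Section Pushforward.
Context (R : nzRingType) (K L : choiceType).
Implicit Types (f : K -> L) (g : L -> option K) (P : set K) (Q : set L).

Definition freeg_map f : {freeg K / R} -> {freeg L / R} :=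
  fglift (fun s => << f s >>).

HB.instance Definition _ f := GRing.Linear.on (freeg_map f).

Definition freeg_pmap g : {freeg L / R} -> {freeg K / R} :=
  fglift (fun s => oapp (fun t => << t >>) 0 (g s)).

HB.instance Definition _ g := GRing.Linear.on (freeg_pmap g).

Lemma freeg_mapU f s : freeg_map f << s >> = << f s >>.
Proof. exact: fgliftU. Qed.

Lemma freeg_pmapU g s :
  freeg_pmap g << s >> = oapp (fun t => << t >>) 0 (g s).
Proof. exact: fgliftU. Qed.

Lemma freeg_mapK f g : pcancel f g -> cancel (freeg_map f) (freeg_pmap g).
Proof.
move=> fK; apply: (eq_linear (f := freeg_pmap g \o freeg_map f)
  (g := idfun)) => s.
by rewrite /= freeg_mapU freeg_pmapU fK.
Qed.

Lemma freeg_pmapK f g c : ocancel g f -> supported [set s | g s] c ->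
  freeg_map f (freeg_pmap g c) = c.
Proof.
move=> gK.
apply: (eq_linear_supported (f := freeg_map f \o freeg_pmap g)
  (g := idfun)) => s.
rewrite /= freeg_pmapU; have := gK s; case: (g s) => //= t <- _.
by rewrite freeg_mapU.
Qed.

Lemma supported_map f P Q c :
  (forall s, P s -> Q (f s)) -> supported P c -> supported Q (freeg_map f c).
Proof. by move=> PQ; apply: supported_lift => s /PQ; apply: supportedU. Qed.

Lemma supported_pmap g P Q c :
  (forall s t, g s = Some t -> Q s -> P t) -> supported Q c ->
  supported P (freeg_pmap g c).
Proof.
move=> QP; apply: supported_lift => s Qs.
case gs: (g s) => [t|]; last exact: supported0.
by apply: supportedU; apply: QP Qs.
Qed.

Lemma supported_image f P c : supported (f @` P) c ->
  exists2 c', supported P c' & freeg_map f c' = c.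
Proof.
elim/supported_ind: c / => [|c1 c2|k _ [s Ps <-]].
- by exists 0; [apply: supported0 | rewrite raddf0].
- move=> [c1' Pc1 <-] [c2' Pc2 <-]; exists (c1' + c2'); first exact: supportedD.
  by rewrite raddfD.
- exists (k *: << s >>); first by apply: supportedZ; apply: supportedU.
  by rewrite linearZ /= freeg_mapU.
Qed.

End Pushforward.

(** * Contractions and cones *)

Local Notation seqchain gamma := {freeg (seq gamma) / int}.
Local Notation prepend x := (freeg_map (cons x)).

Section Contraction.
Context (disp : Order.disp_t) (gamma : orderType disp).
Implicit Types (s : seq gamma) (c : seqchain gamma) (x : gamma).
Implicit Types (phi psi : gamma -> int).

(* Contraction of tuples, seen as exterior products, with a linear form. The
   boundary and the link of a vertex are special cases, so that [contract_cone]
   contains both the cone homotopy formula and the splitting of a chain into the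
   simplices with a given vertex and the others. *)
Fixpoint contract_seq phi s : seqchain gamma :=
  if s is x :: t then phi x *: << t >> - prepend x (contract_seq phi t) else 0.

Definition contract phi : seqchain gamma -> seqchain gamma :=
  fglift (contract_seq phi).

HB.instance Definition _ phi := GRing.Linear.on (contract phi).

Lemma contractU phi s : contract phi << s >> = contract_seq phi s.
Proof. exact: fgliftU. Qed.

Lemma contract_prepend phi x c :
  contract phi (prepend x c) = phi x *: c - prepend x (contract phi c).
Proof.
apply: (eq_linear (f := contract phi \o prepend x)
  (g := phi x \*: idfun \- (prepend x \o contract phi))) => s.
by rewrite /= freeg_mapU !contractU.
Qed.

Lemma contract_anticomm phi psi c :
  contract phi (contract psi c) = - contract psi (contract phi c).
Proof.
apply: (eq_linear (f := contract phi \o contract psi)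
  (g := \- (contract psi \o contract phi))) => s /=.
rewrite !contractU; elim: s => [|x t IH] /=; first by rewrite !raddf0.
rewrite !raddfB /= !linearZ /= !contractU !contract_prepend IH raddfN.
by rewrite /= scalerN !opprK opprD addrCA.
Qed.

Lemma contractK phi c : contract phi (contract phi c) = 0.
Proof.
apply: (eq_linear (f := contract phi \o contract phi) (g := \0)) => s /=.
rewrite contractU; elim: s => [|x t IH] /=; first by rewrite raddf0.
rewrite raddfB /= linearZ /= contractU contract_prepend IH raddf0.
by rewrite subr0 subrr.
Qed.

Lemma supported_contract_seq phi s : sorted <%O s ->
  supported [set u | sorted <%O u /\ exists2 x, phi x != 0 & perm_eq s (x :: u)]
    (contract_seq phi s).
Proof.
elim: s => [|x t IH] st /=; first exact: supported0.
have tst := path_sorted st; apply: supportedB.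
  have [->|phix] := eqVneq (phi x) 0.
    by rewrite scale0r; apply: supported0.
  by apply: supportedZ; apply: supportedU; split=> //; exists x.
apply: supported_map (IH tst) => u [ust [y phiy tyu]]; split; last first.
  exists y => //; rewrite -(perm_cons x) in tyu; apply: perm_trans tyu _.
  by rewrite (perm_catCA [:: x] [:: y]).
move: st; rewrite /= !(path_sortedE lt_trans) ust andbT => /andP[+ _].
by rewrite (perm_all _ tyu) => /andP[].
Qed.

End Contraction.

Local Notation boundary := (contract (fun=> 1)).
Local Notation link v := (contract (fun x => if x == v then 1 else 0)).

Section Cone.
Context (disp : Order.disp_t) (gamma : orderType disp).
Implicit Types (s : seq gamma) (c : seqchain gamma) (v x : gamma).
Implicit Types (phi : gamma -> int).

(* Exterior multiplication on the left by [v], which need not be less than the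
   other vertices. *)
Fixpoint cone_seq v s : seqchain gamma :=
  if s is x :: t then
    if v < x then << v :: s >> else
    if v == x then 0 else - prepend x (cone_seq v t)
  else << [:: v] >>.

Definition cone v : seqchain gamma -> seqchain gamma := fglift (cone_seq v).

HB.instance Definition _ v := GRing.Linear.on (cone v).

Lemma coneU v s : cone v << s >> = cone_seq v s.
Proof. exact: fgliftU. Qed.

Lemma cone_path v s : path <%O v s -> cone v << s >> = << v :: s >>.
Proof. by rewrite coneU; case: s => //= x s /andP[-> _]. Qed.

Lemma cone_prepend_lt v x c : v < x ->
  cone v (prepend x c) = prepend v (prepend x c).
Proof.
move=> vx; apply: (eq_linear (f := cone v \o prepend x)
  (g := prepend v \o prepend x)) => s.
by rewrite /= !freeg_mapU coneU /= vx.
Qed.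

Lemma cone_prepend_eq v c : cone v (prepend v c) = 0.
Proof.
apply: (eq_linear (f := cone v \o prepend v) (g := \0)) => s.
by rewrite /= freeg_mapU coneU /= ltxx eqxx.
Qed.

Lemma cone_prepend_gt v x c : x < v ->
  cone v (prepend x c) = - prepend x (cone v c).
Proof.
move=> xv; apply: (eq_linear (f := cone v \o prepend x)
  (g := \- (prepend x \o cone v))) => s.
by rewrite /= freeg_mapU !coneU /= ltNge (ltW xv) gt_eqF.
Qed.

Lemma contract_cone phi v c : supported (sorted <%O) c ->
  contract phi (cone v c) = phi v *: c - cone v (contract phi c).
Proof.
apply: (eq_linear_supported (f := contract phi \o cone v)
  (g := phi v \*: idfun \- (cone v \o contract phi))) => s /=.
rewrite contractU; elim: s => [|x t IH] /= st.
  by rewrite coneU contractU /= !raddf0.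
rewrite raddfB /= linearZ /=; case: (ltgtP v x) => [vx|xv|xv].
- rewrite (cone_path (_ : path _ v t)).
    rewrite cone_prepend_lt // cone_path ?contractU /= ?vx //.
    by rewrite raddfB /= linearZ /= freeg_mapU.
  by apply: path_le st => //; apply: lt_trans.
- rewrite cone_prepend_gt // opprK coneU /= ltNge (ltW xv) gt_eqF //=.
  rewrite [LHS]raddfN /= contract_prepend -coneU IH ?(path_sorted st) //.
  rewrite opprB [prepend x _]raddfB /= linearZ /= freeg_mapU.
  by rewrite opprD addrA addrAC.
- rewrite -xv in st *.
  rewrite cone_prepend_eq subr0 (cone_path st).
  by rewrite coneU /= ltxx eqxx raddf0 subrr.
Qed.

Lemma supported_cone_seq v s : sorted <%O s ->
  supported [set u | sorted <%O u /\ perm_eq u (v :: s)] (cone_seq v s).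
Proof.
elim: s => [|x t IH] /= st; first exact: supportedU.
case: ltgtP => [vx|xv|_]; last exact: supported0.
  by apply: supportedU; rewrite /= vx.
rewrite -scaleN1r; apply: supportedZ.
apply: supported_map (IH (path_sorted st)) => u [ust uvt]; split.
  rewrite /= (path_sortedE lt_trans) ust (perm_all _ uvt) /= xv.
  by rewrite (order_path_min lt_trans st).
rewrite -(perm_cons x) in uvt; apply: perm_trans uvt _.
by rewrite (perm_catCA [:: x] [:: v]).
Qed.

Lemma cone_mem_eq0 v s : sorted <%O s -> v \in s -> cone v << s >> = 0.
Proof.
elim: s => [//|x t IH] /= st; rewrite coneU inE /=.
case: ltgtP => [vx /= vt|xv /= vt|//].
  have /allP/(_ _ vt) := order_path_min lt_trans st.
  by rewrite ltNge (ltW vx).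
by rewrite -coneU IH ?raddf0 ?oppr0 // (path_sorted st).
Qed.

End Cone.

Section Chains.
Context (disp : Order.disp_t) (gamma : orderType disp).
Implicit Types (s : seq gamma) (c : seqchain gamma) (a v x : gamma).
Implicit Types (A B : set gamma).

(* [k] counts vertices, so that [chains k.+1 A] is P_k(A). *)
Definition simplex_in k A : set (seq gamma) :=
  [set s | [/\ sorted <%O s, size s = k & [set` s] `<=` A]].

Definition chains k A : set (seqchain gamma) := supported (simplex_in k A).

Lemma chainsW k A B c : A `<=` B -> chains k A c -> chains k B c.
Proof.
by move=> AB; apply: supportedW => s [ss sk sA]; split=> // x /sA /AB.
Qed.

Lemma chains_sorted k A c : chains k A c -> supported (sorted <%O) c.
Proof. by apply: supportedW => s []. Qed.

Lemma chains_set0 k c : chains k.+1 set0 c -> c = 0.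
Proof.
move=> c0; apply: supported_set0 => s /c0[_]; case: s => //= x s _ /(_ x).
by apply; rewrite /= mem_head.
Qed.

Lemma chains_contract phi k A c :
  chains k.+1 A c -> chains k A (contract phi c).
Proof.
apply: supported_lift => s [ss sk sA].
apply: supportedW (supported_contract_seq ss) => u [us [x _ sxu]].
split=> //; first by apply/eqP; rewrite -eqSS -sk (perm_size sxu).
by move=> y /= yu; apply: sA; rewrite /= (perm_mem sxu) inE yu orbT.
Qed.

Lemma supported_link v s : sorted <%O s ->
  supported [set u | sorted <%O u /\ perm_eq s (v :: u)] (link v << s >>).
Proof.
move=> ss; rewrite contractU.
apply: supportedW (supported_contract_seq ss) => u [us [x + sxu]].
by case: (eqVneq x v) sxu => // ->.
Qed.

Lemma chains_link k A v c : chains k.+1 A c -> chains k (A `\ v) (link v c).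
Proof.
apply: supported_lift => s [ss sk sA]; rewrite -contractU.
apply: supportedW (supported_link ss) => u [us svu].
have := sorted_uniq lt_trans ltxx ss.
rewrite (perm_uniq svu) /= => /andP[vu _].
split=> //; first by apply/eqP; rewrite -eqSS -sk (perm_size svu).
move=> y /= yu; split.
  by apply: sA; rewrite /= (perm_mem svu) inE yu orbT.
by move=> yv; rewrite -yv yu in vu.
Qed.

Lemma chains_cone k A v c : A v -> chains k A c -> chains k.+1 A (cone v c).
Proof.
move=> Av; apply: supported_lift => s [ss sk sA].
apply: supportedW (supported_cone_seq ss) => u [us uvs].
split=> [||x] /=; first exact: us.
  by rewrite (perm_size uvs) /= sk.
by rewrite (perm_mem uvs) inE => /orP[/eqP->|/sA].
Qed.

Lemma link_notin k A v c : ~ A v -> chains k A c -> link v c = 0.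
Proof.
move=> nAv; apply: (eq_linear_supported (f := link v) (g := \0)).
move=> s [ss _ sA] /=; apply: supported_set0.
apply: supportedW (supported_link ss) => u [_ svu]; apply: nAv; apply: sA.
by rewrite /= (perm_mem svu) mem_head.
Qed.

Lemma link_cone k A v c :
  chains k A c -> link v (cone v c) = c - cone v (link v c).
Proof. by move=> /chains_sorted cs; rewrite contract_cone // eqxx scale1r. Qed.

Lemma chains_sub_cone_link k A v c :
  chains k A c -> chains k (A `\ v) (c - cone v (link v c)).
Proof.
move=> cA; rewrite -(link_cone _ cA).
apply: (@chainsW _ ((v |` A) `\ v)) => [x [[xv|Ax] nxv] //|].
apply: chains_link; apply: chains_cone; first by left.
by apply: chainsW cA => x; right.
Qed.

Lemma boundary_cone k A v c :
  chains k A c -> boundary (cone v c) = c - cone v (boundary c).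
Proof. by move=> /chains_sorted cs; rewrite contract_cone // scale1r. Qed.

Lemma boundary_cone_cycle k A v c :
  chains k A c -> boundary c = 0 -> boundary (cone v c) = c.
Proof. by move=> /boundary_cone-> ->; rewrite raddf0 subr0. Qed.

Lemma boundary_cone_boundary k A v c :
  chains k.+1 A c -> boundary (cone v (boundary c)) = boundary c.
Proof.
move=> cA; have dcA : chains k A (boundary c) by apply: chains_contract.
by apply: boundary_cone_cycle dcA _; rewrite contractK.
Qed.

Lemma cycle_is_boundary k A c : chains k.+1 A c -> boundary c = 0 ->
  exists2 c', chains k.+2 A c' & boundary c' = c.
Proof.
move=> cA dc; have [->|/freeg_neq0[s sc]] := pselect (c = 0).
  by exists 0; [apply: supported0 | rewrite raddf0].
have [_ + sA] := cA s sc; case: s sA {sc} => // v s sA _.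
exists (cone v c); last exact: boundary_cone_cycle cA dc.
by apply: chains_cone => //; apply: sA; rewrite /= mem_head.
Qed.

Lemma cone_eq0 k A v c :
  chains k A c -> supported [set s : seq gamma | v \in s] c -> cone v c = 0.
Proof.
move=> /chains_sorted cs vc.
apply: (eq_linear_supported (f := cone v) (g := \0)) (supportedI cs vc).
by move=> s [ss vs]; apply: cone_mem_eq0.
Qed.

Lemma boundary_simplex_neq0 k A s :
  simplex_in k.+1 A s -> boundary << s >> <> 0.
Proof.
move=> sA; have sc : chains k.+1 A << s >> by apply: supportedU.
have [_ + _] := sA; case: s sA sc => // v s [ss _ _] sc _ ds0.
have := boundary_cone_cycle v sc ds0; rewrite cone_mem_eq0 ?mem_head // raddf0.
by move=> /esym/eqP; rewrite freegU_eq0.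
Qed.

Definition tail_of A a : set gamma := A `&` [set x | a <= x].

Definition below A a : set gamma := A `&` [set x | x < a].

Lemma simplex_in_tail k A x s :
  simplex_in k A (x :: s) -> simplex_in k (tail_of A x) (x :: s).
Proof.
case=> ss sk sA; split=> // y ys; split; first exact: sA.
move: ys; rewrite /= inE => /orP[/eqP->//|ys]; apply: ltW.
by move/allP: (order_path_min lt_trans ss); apply.
Qed.

End Chains.

(** * Acyclic sets of simplices *)

Section AcyclicFamilies.
Context (disp : Order.disp_t) (gamma : orderType disp).
Implicit Types (c : seqchain gamma) (a b : gamma) (m : nat).
Implicit Types (A B : set gamma) (S : set (seq gamma)).

Definition spanning S m B : Prop := forall c, chains m.+1 B c ->
  exists c', [/\ chains m.+1 B c', supported S c' & boundary c' = boundary c].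

Definition independent S m B : Prop := forall c, chains m.+1 B c ->
  supported S c -> boundary c = 0 -> c = 0.

(* [S] is the set of m-faces of an m-dimensional tail-acyclic complex on [A]. *)
Definition acyclic_faces S m A : Prop :=
  (forall a, spanning S m (tail_of A a)) /\ independent S m A.

Definition acyclic_on m A : Prop := exists S, acyclic_faces S m A.

Lemma spanning_set0 S m : spanning S m set0.
Proof.
by move=> c /chains_set0->; exists 0; split=> //; apply: supported0.
Qed.

Lemma acyclic_on_set0 m : acyclic_on m set0.
Proof.
exists setT; split=> [a|c /chains_set0 //].
by rewrite /tail_of set0I; apply: spanning_set0.
Qed.

Lemma star_spanning m B b : B b -> spanning [set s | b \in s] m B.
Proof.
move=> Bb c cB; have dcB : chains m B (boundary c) by apply: chains_contract.
exists (cone b (boundary c)); split.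
- exact: chains_cone Bb dcB.
- apply: supported_lift dcB => s [ss _ _].
  apply: supportedW (supported_cone_seq ss) => u [_ ubs].
  by rewrite /= (perm_mem ubs) mem_head.
- exact: boundary_cone_boundary cB.
Qed.

Lemma star_independent m B b : independent [set s | b \in s] m B.
Proof.
move=> c cB bc dc; rewrite -(boundary_cone_cycle b cB dc).
by rewrite (cone_eq0 cB bc) raddf0.
Qed.

Lemma acyclic_on_max m A b :
  A b -> (forall x, A x -> x <= b) -> acyclic_on m A.
Proof.
move=> Ab bmax; exists [set s | b \in s]; split; last exact: star_independent.
move=> a; case: (leP a b) => [ab|ba]; first by apply: star_spanning.
suff -> : tail_of A a = set0 by apply: spanning_set0.
rewrite -subset0 => x [/bmax xb ax].
by have := le_trans ax xb; rewrite leNgt ba.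
Qed.

End AcyclicFamilies.

Lemma seq_argmax (T : eqType) (disp : Order.disp_t) (W : orderType disp)
    (f : T -> W) x s :
  exists2 v, v \in x :: s & forall y, y \in x :: s -> f y <= f v.
Proof.
elim: s x => [|y s IH] x.
  by exists x => [|z]; rewrite ?mem_head // inE => /eqP->.
have [v vs vmax] := IH y; have [xv|vx] := leP (f x) (f v).
  exists v => [|z]; first by rewrite inE vs orbT.
  by rewrite inE => /orP[/eqP->|/vmax].
exists x => [|z]; rewrite inE ?eqxx // => /orP[/eqP->//|/vmax zv].
exact: le_trans zv (ltW vx).
Qed.

Section Insertion.
Context (disp dispW : Order.disp_t) (gamma : orderType disp).
Context (W : orderType dispW) (rank : gamma -> W).
Implicit Types (s t : seq gamma) (c w : seqchain gamma) (a v x : gamma).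
Implicit Types (B : set gamma).

Definition before B v : set gamma := B `&` [set x | rank x < rank v].

Definition upto B v : set gamma := B `&` [set x | rank x <= rank v].

Lemma max_vertex k B c : chains k.+1 B c -> c <> 0 ->
  exists v, [/\ B v, exists2 s, s \in dom c & v \in s &
    chains k.+1 (upto B v) c].
Proof.
move=> cB /freeg_neq0[s sc]; have [_ + _] := cB s sc.
case: s sc => // x s sc _.
have [v v_max vmax] := seq_argmax rank x (flatten (dom c)).
have [u uc vu] : exists2 u, u \in dom c & v \in u.
  move: v_max; rewrite inE => /orP[/eqP->|/flattenP//].
  by exists (x :: s); rewrite ?mem_head.
exists v; split; last 1 first.
- move=> t tc; have [st tk tB] := cB t tc; split=> // y yt.
  split; first exact: tB.
  by apply: vmax; rewrite inE; apply/orP; right; apply/flattenP; exists t.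
- by have [_ _] := cB u uc; apply.
- by exists u.
Qed.

Context (m : nat) (A : set gamma) (S : gamma -> set (seq gamma)).

Definition inserted : set (seq gamma) :=
  [set s | exists v t, [/\ perm_eq s (v :: t), sorted <%O t, S v t &
     [set` t] `<=` [set x | rank x < rank v]]].

Lemma inserted_cone v k w : chains k (before A v) w -> supported (S v) w ->
  supported inserted (cone v w).
Proof.
move=> wA wS; apply: supported_lift (supportedI wA wS) => t [[st _ tA] St].
apply: supportedW (supported_cone_seq st) => u [_ uvt].
by exists v, t; split=> // x /tA[].
Qed.

Lemma inserted_link v k c : chains k (upto A v) c -> supported inserted c ->
  supported (S v) (link v c).
Proof.
move=> cA cT; apply: supported_lift (supportedI cA cT) => s [[ss _ sA]].
case=> v' [t [sv't st St tv']]; rewrite -contractU.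
apply: supportedW (supported_link ss) => u [su svu].
have vs : v \in s by rewrite (perm_mem svu) mem_head.
have v's : v' \in s by rewrite (perm_mem sv't) mem_head.
have vv' : v' = v.
  move: vs; rewrite (perm_mem sv't) inE => /orP[/eqP//|/tv'/=].
  by have [_ /=] := sA v' v's; rewrite leNgt => /negbTE->.
rewrite vv' in sv't St; suff -> : u = t by [].
apply: (irr_sorted_eq lt_trans ltxx su st); apply: perm_mem.
by rewrite -(perm_cons v) -(permPl svu).
Qed.

Hypothesis W_wf : well_ordered W.
Hypothesis rank_inj : injective rank.
Hypothesis S_span : forall v a, A v -> a <= v ->
  spanning (S v) m (tail_of (before A v) a).
Hypothesis S_indep : forall v, A v -> independent (S v) m (before A v).

Lemma upto_setD1 B v : upto B v `\ v `<=` before B v.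
Proof.
move=> x [[Bx xv] nxv]; split=> //; rewrite /= lt_neqAle xv andbT.
by apply/eqP => /rank_inj.
Qed.

Lemma inserted_independent : independent inserted m.+1 A.
Proof.
move=> c cA cT dc; apply: contrapT => c0.
have [v [Av [s sc vs] cv]] := max_vertex cA c0.
have wv : chains m.+1 (before A v) (link v c).
  exact: chainsW (@upto_setD1 A v) (chains_link cv).
have dw : boundary (link v c) = 0 by rewrite contract_anticomm dc !raddf0.
have w0 : link v c = 0 := S_indep Av wv (inserted_link cv cT) dw.
have := chains_sub_cone_link (v := v) cv; rewrite w0 raddf0 subr0.
by move=> /(_ s sc)[_ _ /(_ v vs)[_]]; apply.
Qed.

Lemma fill_link a v c : chains m.+2 (upto (tail_of A a) v) c ->
  exists w, [/\ chains m.+1 (before (tail_of A a) v) w,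
    boundary w = boundary (link v c), supported inserted (cone v w) &
    chains m.+2 (tail_of A a) (cone v w)].
Proof.
move=> cv; have [[Av av]|nAv] := pselect (tail_of A a v); last first.
  exists 0; rewrite (link_notin _ cv) => [|[/nAv//]].
  by rewrite !raddf0; split=> //; apply: supported0.
have beforeE : before (tail_of A a) v = tail_of (before A v) a.
  by rewrite /before /tail_of setIAC.
have [|w [wA wS dw]] := S_span Av av (c := link v c).
  by rewrite -beforeE; apply: chainsW (@upto_setD1 _ v) (chains_link cv).
exists w; rewrite beforeE; split=> //.
- by apply: inserted_cone wS; apply: chainsW wA => x [].
- by apply: chains_cone => //; apply: chainsW wA => x [[]].
Qed.

Lemma inserted_spanning_upto a v c : chains m.+2 (upto (tail_of A a) v) c ->
  exists c', [/\ chains m.+2 (tail_of A a) c', supported inserted c' &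
    boundary c' = boundary c].
Proof.
elim/(well_founded_ind (wf_inverse_image _ _ _ rank W_wf)): v c => v IH c cv.
have [w [wv dw wT wA]] := fill_link cv.
have linkv : chains m.+1 (before (tail_of A a) v) (link v c).
  exact: chainsW (@upto_setD1 _ v) (chains_link cv).
pose d := c - cone v (link v c).
have d_before : chains m.+2 (before (tail_of A a) v) d.
  exact: chainsW (@upto_setD1 _ v) (chains_sub_cone_link cv).
have [|e ev de] := cycle_is_boundary (supportedB linkv wv).
  by rewrite raddfB /= dw subrr.
have [c' [c'A c'T dc']] : exists c', [/\ chains m.+2 (tail_of A a) c',
    supported inserted c' & boundary c' = boundary (d + e)].
  have bv := supportedD d_before ev.
  have [->|/(max_vertex bv)[v' [[_ v'v] _ bv']]] := pselect (d + e = 0).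
    by exists 0; split=> //; apply: supported0.
  by apply: (IH v') => //; apply: chainsW bv' => x [[]].
exists (c' + cone v w); split; [exact: supportedD | exact: supportedD |].
have bd_d : boundary d = boundary c - (link v c - cone v (boundary (link v c))).
  by rewrite raddfB /= (boundary_cone _ linkv).
rewrite raddfD /= dc' raddfD /= de bd_d (boundary_cone _ wv) dw.
by rewrite opprB -!addrA !addKr subrr addr0.
Qed.

Lemma acyclic_on_insertion : acyclic_on m.+1 A.
Proof.
exists inserted; split; last exact: inserted_independent.
move=> a c cA; have [->|c0] := pselect (c = 0).
  by exists 0; split=> //; apply: supported0.
by have [v [_ _ cv]] := max_vertex cA c0; apply: inserted_spanning_upto cv.
Qed.

End Insertion.

Lemma well_ordered_bool : well_ordered bool.
Proof.
have acc_false : Acc (fun x y : bool => x < y) false by constructor=> -[].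
by case; [constructor=> -[] | exact: acc_false].
Qed.

Lemma well_ordered_nat : well_ordered nat.
Proof.
by move=> n; elim/ltn_ind: n => n IH; constructor => m /= mn; apply: IH.
Qed.

Lemma well_ordered_lexi (d1 d2 : Order.disp_t) (T1 : orderType d1)
    (T2 : orderType d2) :
  well_ordered T1 -> well_ordered T2 -> well_ordered (T1 *l T2)%type.
Proof.
move=> wf1 wf2; apply: wf_incl (wf_slexprod _ _ _ _ wf1 wf2).
move=> [x1 x2] [y1 y2]; rewrite ltxi_pair => /andP[].
rewrite le_eqVlt => /orP[/eqP<-|xy _]; last by left.
by rewrite lexx; right.
Qed.

Lemma well_ordered_min (disp : Order.disp_t) (gamma : orderType disp)
    (P : set gamma) : well_ordered gamma ->
  P !=set0 -> exists2 x, P x & forall y, P y -> x <= y.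
Proof.
move=> gamma_wf [x]; elim/(well_founded_ind gamma_wf): x => x IH Px.
have [[y Py yx]|nP] := pselect (exists2 y, P y & y < x).
  exact: IH yx Py.
exists x => // y Py; rewrite leNgt; apply/negP => yx.
by apply: nP; exists y.
Qed.

Section CofinalSubsets.
Context (disp : Order.disp_t) (gamma : orderType disp).
Hypothesis gamma_wf : well_ordered gamma.
Implicit Types (a d x y : gamma) (A D : set gamma).

Definition cofinal_in A D : Prop :=
  D `<=` A /\ forall x, A x -> exists2 y, D y & x <= y.

(* Insert first the elements of [D] in increasing order, and then the others,
   coning [v] over an element of [D] above [v]. *)
Lemma acyclic_on_cofinal m A D : cofinal_in A D ->
  (forall d, D d -> acyclic_on m (below D d)) -> acyclic_on m.+1 A.
Proof.
move=> [DA Dcof] Dac.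
pose rank x : bool *l gamma := (~~ `[< D x >], x).
have rank_inj : injective rank by move=> x y [].
have rank_wf := well_ordered_lexi well_ordered_bool gamma_wf.
have before_in v : D v -> before rank A v = below D v.
  move=> Dv; apply/seteqP.
  split=> x; rewrite /before /rank /= ltxi_pair (asboolT Dv).
    by move=> [_]; case: asboolP => // Dx; split.
  by move=> [Dx xv]; split; [apply: DA | rewrite asboolT].
have before_out v y : ~ D v -> D y -> before rank A v y.
  by move=> Dv Dy; split; [apply: DA | rewrite /= ltxi_pair asboolT // asboolF].
have /choice[S SP] v : exists S, A v ->
    (forall a, a <= v -> spanning S m (tail_of (before rank A v) a)) /\
    independent S m (before rank A v).
  have [Dv|nDv] := pselect (D v).
    by have [S [Sspan Sind]] := Dac v Dv; exists S => _; rewrite before_in.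
  have [/Dcof[r Dr vr]|] := pselect (A v); last by exists set0.
  exists [set s | r \in s] => _; split; last exact: star_independent.
  move=> a av; apply: star_spanning.
  by split; [apply: before_out | apply: le_trans vr].
apply: (acyclic_on_insertion rank_wf rank_inj (S := S)).
- by move=> v a /SP[+ _]; apply.
- by move=> v /SP[].
Qed.

End CofinalSubsets.

(** * Splittings of the boundary map *)

Section Splittings.
Context (disp : Order.disp_t) (gamma : orderType disp).
Implicit Types (s : seq gamma) (c : seqchain gamma) (x y a d : gamma).
Implicit Types (f : {linear seqchain gamma -> seqchain gamma}).
Implicit Types (A D : set gamma) (r : gamma -> gamma).

(* [f] is [sigma \o boundary] for a section [sigma] of [boundary] that preserves
   all tails of [A]. *)
Definition is_splitting m A f : Prop :=
  [/\ forall a c, chains m.+1 (tail_of A a) c ->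
        chains m.+1 (tail_of A a) (f c),
      forall c, chains m.+1 A c -> boundary (f c) = boundary c &
      forall c, chains m.+1 A c -> boundary c = 0 -> f c = 0].

Definition splits m A : Prop := exists f, is_splitting m A f.

Lemma splitting_chains m A f c :
  is_splitting m A f -> chains m.+1 A c -> chains m.+1 A (f c).
Proof.
case=> ftail _ _; apply: supported_linear => -[[]//|x s] sA.
apply: (@chainsW _ _ _ (tail_of A x)); first by move=> y [].
by apply: ftail; apply: supportedU; apply: simplex_in_tail.
Qed.

Lemma splitting_eq m A f b c : is_splitting m A f ->
  chains m.+1 A b -> chains m.+1 A c -> boundary b = boundary c -> f b = f c.
Proof.
case=> _ _ f0 bA cA dbc; apply/eqP; rewrite -subr_eq0 -raddfB; apply/eqP/f0.
  exact: supportedB.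
by rewrite raddfB /= dbc subrr.
Qed.

Lemma splits0_acyclic_on A : splits 0 A -> acyclic_on 0 A.
Proof.
case=> f fP; have [ftail bd_f _] := fP.
have [->|/set0P[x Ax]] := eqVneq A set0.
  exact: acyclic_on_set0.
have vertex y : A y -> chains 1 (tail_of A y) << [:: y] >>.
  move=> Ay; apply: supportedU; split=> // z; rewrite /= inE => /eqP->.
  by split=> /=.
have vertexA y : A y -> chains 1 A << [:: y] >>.
  by move=> /vertex; apply: chainsW => z [].
have bd_vertex y : boundary << [:: y] >> = << [::] >>.
  by rewrite contractU /= raddf0 subr0 scale1r.
have f_cst z : A z -> f << [:: z] >> = f << [:: x] >>.
  by move=> Az; apply: (splitting_eq fP); rewrite ?bd_vertex //; apply: vertexA.
have [|s s_dom] := @freeg_neq0 _ _ (f << [:: x] >>).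
  move=> fx0; have := bd_f _ (vertexA x Ax); rewrite fx0 raddf0 bd_vertex.
  by move=> /esym/eqP; rewrite freegU_eq0.
have s_tail z : A z -> simplex_in 1 (tail_of A z) s.
  by move=> Az; apply: (ftail z _ (vertex z Az)); rewrite f_cst.
have [_] := s_tail x Ax; case: s s_tail {s_dom} => [|y []] //= s_tail _.
move=> /(_ y)[|Ay _]; first by rewrite /= mem_head.
apply: (@acyclic_on_max _ _ 0 A y) => // z /s_tail[_ _ /(_ y)].
by case=> //=; rewrite mem_head.
Qed.

(* The map on chains induced by a vertex map; the cones take care of the sign of
   the sorting permutation and kill degenerate simplices. *)
Definition push r : seqchain gamma -> seqchain gamma :=
  fglift (foldr (fun x c => cone (r x) c) << [::] >>).

HB.instance Definition _ r := GRing.Linear.on (push r).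

Lemma push_nil r : push r << [::] >> = << [::] >>.
Proof. exact: fgliftU. Qed.

Lemma push_cons r x s : push r << x :: s >> = cone (r x) (push r << s >>).
Proof. by rewrite /push !fgliftU. Qed.

Lemma push_prepend r x c : push r (prepend x c) = cone (r x) (push r c).
Proof.
apply: (eq_linear (f := push r \o prepend x) (g := cone (r x) \o push r)).
by move=> s; rewrite /= freeg_mapU push_cons.
Qed.

Lemma chains_push r k A D c :
  {homo r : x / A x >-> D x} -> chains k A c -> chains k D (push r c).
Proof.
move=> rAD; apply: supported_linear => s [_ <- /=].
rewrite -/(chains _ _ _); elim: s => [|x s IH] sA.
  by rewrite push_nil; apply: supportedU.
rewrite push_cons; apply: chains_cone.
  by apply/rAD/sA; rewrite /= mem_head.
by apply: IH => y ys; apply: sA; rewrite /= inE ys orbT.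
Qed.

Lemma push_id r k D c :
  {in D, r =1 id} -> chains k D c -> push r c = c.
Proof.
move=> rD; apply: (eq_linear_supported (f := push r) (g := idfun)) => s.
case=> + _ /=; elim: s => [|x s IH] ss sD; first by rewrite push_nil.
rewrite push_cons IH ?(path_sorted ss) //.
  by rewrite rD ?cone_path // inE; apply: sD; rewrite /= mem_head.
by move=> y ys; apply: sD; rewrite /= inE ys orbT.
Qed.

Lemma boundary_push r c : boundary (push r c) = push r (boundary c).
Proof.
apply: (eq_linear (f := boundary \o push r) (g := push r \o boundary)) => s.
rewrite /=; elim: s => [|x s IH].
  by rewrite push_nil !contractU /= raddf0.
have pushs : chains (size s) setT (push r << s >>).
  elim: s {IH} => [|y s IH]; first by rewrite push_nil; apply: supportedU.
  by rewrite push_cons; apply: chains_cone.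
rewrite push_cons (boundary_cone _ pushs) IH [in RHS]contractU /=.
by rewrite scale1r raddfB /= push_prepend contractU.
Qed.

Lemma splits_cofinal m A D : cofinal_in A D -> splits m A -> splits m D.
Proof.
move=> [DA Dcof] [f fP]; have [ftail bd_f f0] := fP.
have /choice[r rP] x : exists y, (D x -> y = x) /\ (A x -> D y /\ x <= y).
  have [Dx|nDx] := pselect (D x); first by exists x.
  have [/Dcof[y Dy xy]|nAx] := pselect (A x); first by exists y.
  by exists x; split=> // /nAx.
have rid : {in D, r =1 id} by move=> x; rewrite inE => /(proj1 (rP x)).
have chainsDA k c : chains k D c -> chains k A c by apply: chainsW.
exists (push r \o f : {linear _ -> _}); split=> [a c cD|c cD|c cD c0] /=.
- apply: (@chains_push _ _ (tail_of A a)).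
    by move=> x [/(proj2 (rP x))[Dr xr] ax]; split=> //; apply: le_trans xr.
  by apply: ftail; apply: chainsW cD => x [/DA].
- rewrite boundary_push bd_f; last exact: chainsDA.
  by apply: (push_id rid (k := m)); apply: chains_contract.
- by rewrite f0 ?raddf0 //; apply: chainsDA.
Qed.

Definition truncate d : seqchain gamma -> seqchain gamma :=
  freeg_pmap (fun s => if all (fun x => x < d) s then Some s else None).

HB.instance Definition _ d := GRing.Linear.on (truncate d).

Lemma chains_truncate k A d c :
  chains k A c -> chains k (below A d) (truncate d c).
Proof.
apply: supported_pmap => s t; case: allP => // sd [<-] [ss sk sA].
by split=> // x xs; split; [apply: sA | apply: sd].
Qed.

Lemma truncate_id k A d c : chains k (below A d) c -> truncate d c = c.
Proof.
apply: (eq_linear_supported (f := truncate d) (g := idfun)) => s [_ _ sA] /=.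
by rewrite /truncate freeg_pmapU; case: allP => // -[] x /sA[].
Qed.

(* A simplex [s] below [d] is corrected by the boundary of the part below [d] of
   the splitting of the cone over [s] with apex [d]. *)
Lemma splits_below m D f d : is_splitting m.+1 D f -> D d ->
  (forall c, chains m.+2 (below D d) c -> chains m.+2 (below D d) (f c)) ->
  splits m (below D d).
Proof.
move=> fP Dd f_below; have [ftail bd_f _] := fP.
have belowD k c : chains k (below D d) c -> chains k D c.
  by apply: chainsW => x [].
exists (idfun \- (boundary \o truncate d \o f \o cone d) : {linear _ -> _}).
split=> [a c cD|c cD|c cD dc] /=.
- apply: supportedB => //; have [ad|da] := leP a d.
    rewrite -/(chains _ _ _) /tail_of /below setIAC.
    apply: chains_contract; apply: chains_truncate; apply: ftail.
    by apply: chains_cone => //; apply: chainsW cD => x [[]].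
  suff -> : c = 0 by rewrite !raddf0; apply: supported0.
  apply: chains_set0; apply: chainsW cD => x [[_ xd] ax].
  by have := lt_trans (le_lt_trans ax xd) da; rewrite ltxx.
- by rewrite raddfB /= contractK subr0.
have [w wD dw] := cycle_is_boundary cD dc.
have -> : f (cone d c) = f w.
  apply: (splitting_eq fP); [|exact: belowD|].
    by apply: chains_cone => //; apply: belowD.
  by rewrite dw (boundary_cone_cycle d cD dc).
by rewrite (truncate_id (f_below w wD)) (bd_f _ (belowD _ _ wD)) dw subrr.
Qed.

End Splittings.

(** * Cofinal subsets *)

Section EmptyOrMax.
Context (disp : Order.disp_t) (gamma : orderType disp).
Implicit Types (B : set gamma) (s : seq gamma).

Definition empty_or_max B : Prop :=
  B = set0 \/ exists2 b, B b & forall x, B x -> x <= b.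

Lemma acyclic_on_empty_or_max m B : empty_or_max B -> acyclic_on m B.
Proof.
case=> [->|[b Bb bmax]]; first exact: acyclic_on_set0.
exact: acyclic_on_max Bb bmax.
Qed.

Lemma sub_seq_empty_or_max B s : B `<=` [set` s] -> empty_or_max B.
Proof.
move=> Bs; have [->|/set0P[x Bx]] := eqVneq B set0; first by left.
have [v vin vmax] := seq_argmax id x [seq y <- s | `[< B y >]].
right; exists v => [|y By].
  by move: vin; rewrite inE mem_filter => /orP[/eqP->|/andP[/asboolP]].
by apply: vmax; rewrite inE mem_filter (Bs y) // asboolT // orbT.
Qed.

End EmptyOrMax.

Section BelowCofinality.
Context (disp : Order.disp_t) (gamma : orderType disp).
Implicit Types (A D : set gamma) (b x : gamma).

(* Holds when the cardinality of [B] is less than the cofinality of [A]. *)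
Definition below_cof (I : Type) (B : set I) A : Prop :=
  forall u : I -> gamma, (forall i, A (u i)) ->
  exists2 b, A b & forall i, B i -> u i < b.

Lemma not_below_cof (I : Type) (B : set I) A : ~ below_cof B A ->
  exists2 u : I -> gamma, (forall i, A (u i)) & cofinal_in A (u @` B).
Proof.
move=> /existsNP[u /not_implyP[uA unbounded]]; exists u => //.
split=> [_ [i _ <-] //|x Ax]; apply: contrapT => nx.
apply: unbounded; exists x => // i Bi; rewrite ltNge; apply/negP => xui.
by apply: nx; exists (u i) => //; exists i.
Qed.

Lemma below_cof_sub_image (I J : Type) (f : I -> J) (B : set I) (B' : set J) A :
  B' `<=` f @` B -> below_cof B A -> below_cof B' A.
Proof.
move=> B'f Bcof u uA; have [b Ab ub] := Bcof (u \o f) (fun i => uA (f i)).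
by exists b => // _ /B'f[i Bi <-]; apply: ub.
Qed.

Lemma below_cof_seqs (T : eqType) (B : set T) A k :
  below_cof [set: nat] A -> below_cof B A ->
  below_cof [set s : seq T | size s = k /\ [set` s] `<=` B] A.
Proof.
move=> countable_below Bcof; elim: k => [|k IH] u uA.
  have [b Ab ub] := countable_below (fun=> u [::]) (fun=> uA _).
  by exists b => // s [/size0nil-> _]; apply: (ub 0%N).
have /choice[h hP] i : exists b, A b /\
    forall s, size s = k /\ [set` s] `<=` B -> u (i :: s) < b.
  by have [b Ab ub] := IH (u \o cons i) (fun=> uA _); exists b.
have [b Ab hb] := Bcof h (fun i => proj1 (hP i)).
exists b => // -[[]//|i s] [[sk] sB].
apply: lt_trans (hb i _); last by apply: sB; rewrite /= mem_head.
apply: (proj2 (hP i)); split=> // j js.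
by apply: sB; rewrite /= inE js orbT.
Qed.

Lemma seq_bounded A x s : below_cof [set: nat] A -> [set` x :: s] `<=` A ->
  exists2 b, A b & forall y, y \in x :: s -> y < b.
Proof.
move=> countable_below sA; have [|b Ab xb] := countable_below (nth x (x :: s)).
  move=> i; case: (ltnP i (size (x :: s))) => si.
    by apply: sA; apply: mem_nth.
  by rewrite nth_default //; apply: sA; rewrite /= mem_head.
by exists b => // y ys; rewrite -(nth_index x ys); apply: xb.
Qed.

Lemma chains_bounded k A D x c : below_cof [set: nat] A -> D `<=` A -> A x ->
  chains k D c -> exists2 b, A b & chains k (below D b) c.
Proof.
move=> countable_below DA Ax cD.
have [|b Ab vb] := @seq_bounded A x (flatten (dom c)) countable_below.
  move=> y; rewrite /= inE => /orP[/eqP->//|/flattenP[s sc ys]].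
  by have [_ _ sD] := cD s sc; apply/DA/sD.
exists b => // s sc; have [ss sk sD] := cD s sc; split=> // y ys.
split; first exact: sD.
by apply: vb; rewrite inE; apply/orP; right; apply/flattenP; exists s.
Qed.

End BelowCofinality.

Section Records.
Context (dispI disp : Order.disp_t) (I : orderType dispI).
Context (gamma : orderType disp) (B : set I) (u : I -> gamma).
Implicit Types (i j : I) (A : set gamma).

Definition record_indices : set I :=
  [set i | B i /\ forall j, B j -> j < i -> u j < u i].

Definition records : set gamma := u @` record_indices.

Lemma records_cofinal A : well_ordered I ->
  cofinal_in A (u @` B) -> cofinal_in A records.
Proof.
move=> I_wf [uA ucof]; split=> [_ [i [Bi _] <-]|x Ax].
  by apply: uA; exists i.
have [|i [Bi xi] imin] :=
    well_ordered_min I_wf (P := [set i | B i /\ x <= u i]).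
  by have [_ [i Bi <-] xi] := ucof x Ax; exists i.
exists (u i) => //; exists i => //; split=> // j Bj ji.
rewrite ltNge; apply/negP => uij.
by have := imin j (conj Bj (le_trans xi uij)); rewrite leNgt ji.
Qed.

Lemma below_records i :
  record_indices i -> below records (u i) `<=` u @` below B i.
Proof.
move=> [Bi _] _ [[j [Bj jrec] <-] /= uji]; exists j => //; split=> //=.
rewrite ltNge; apply/negP; rewrite le_eqVlt => /orP[/eqP ij|ij].
  by rewrite ij ltxx in uji.
by have := lt_trans uji (jrec i Bi ij); rewrite ltxx.
Qed.

End Records.

Section RegularCofinality.
Context (disp : Order.disp_t) (gamma : orderType disp).
Implicit Types (A D : set gamma).

Lemma cofinal_omega A : ~ below_cof [set: nat] A ->
  exists2 D, cofinal_in A D & forall d, D d -> empty_or_max (below D d).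
Proof.
move=> /not_below_cof[u _ ucof].
exists (records setT u); first exact: records_cofinal well_ordered_nat ucof.
move=> _ [k krec <-]; apply: (@sub_seq_empty_or_max _ _ _ (map u (iota 0 k))).
move=> x /(below_records krec)[j [_ jk] <-].
by apply: map_f; rewrite mem_iota.
Qed.

(* [D] has a regular order type: it consists of the values at which a family
   indexed by an initial segment of [A], as short as possible and unbounded in
   [A], exceeds all its previous values. *)
Lemma cofinal_regular A : well_ordered gamma ->
  exists2 D, cofinal_in A D & forall d, D d -> below_cof (below D d) A.
Proof.
move=> gamma_wf.
have [Areg|] := pselect (forall b, A b -> below_cof (below A b) A).
  by exists A => //; split=> // x Ax; exists x.
move=> /existsNP/(well_ordered_min gamma_wf)[b /not_implyP[_ ]].
move=> /not_below_cof[u uA ucof] bmin.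
exists (records (below A b) u); first exact: records_cofinal gamma_wf ucof.
move=> _ [i irec <-]; have [[Ai ib] _] := irec.
apply: below_cof_sub_image (below_records irec) _.
apply: contrapT => icof; have : b <= i.
  apply: bmin; apply/not_implyP; split=> // Aicof; apply: icof.
  by apply: below_cof_sub_image Aicof => j [[Aj _] ji]; exists j.
by rewrite leNgt => /negP.
Qed.

End RegularCofinality.

Section ClosedPoints.
Context (disp : Order.disp_t) (gamma : orderType disp).
Context (A D : set gamma) (m : nat).
Context (f : {linear seqchain gamma -> seqchain gamma}).
Implicit Types (d e x y : gamma) (P : set gamma).
Hypothesis gamma_wf : well_ordered gamma.
Hypothesis Dcof : cofinal_in A D.
Hypothesis Dreg : forall d, D d -> below_cof (below D d) A.
Hypothesis countable_below : below_cof [set: nat] A.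
Hypothesis fD : forall c, chains m.+1 D c -> chains m.+1 D (f c).

Definition maps_below d e : Prop := forall s,
  simplex_in m.+1 (below D d) s -> chains m.+1 (below D e) (f << s >>).

Definition closed_points : set gamma := D `&` [set d | maps_below d d].

Lemma maps_below_le d d' e e' :
  d' <= d -> e <= e' -> maps_below d e -> maps_below d' e'.
Proof.
move=> dd' ee' de s [ss sk sd'].
apply: (@chainsW _ _ _ (below D e)) => [y [Dy ye]|].
  by split=> //; apply: lt_le_trans ye ee'.
apply: de; split=> // y /sd'[Dy yd'].
by split=> //; apply: lt_le_trans yd' dd'.
Qed.

Lemma maps_below_next x : A x -> exists y, [/\ D y, x < y & maps_below x y].
Proof.
move=> Ax; have [DA cofD] := Dcof.
have /choice[F FP] s : exists b, A b /\
    (simplex_in m.+1 D s -> chains m.+1 (below D b) (f << s >>)).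
  have [sD|nsD] := pselect (simplex_in m.+1 D s); last by exists x.
  have [b Ab sb] := chains_bounded countable_below DA Ax (fD (supportedU sD)).
  by exists b.
have [d Dd xd] := cofD x Ax.
have [b Ab Fb] :=
  below_cof_seqs m.+1 countable_below (Dreg Dd) (fun s => proj1 (FP s)).
have [|c Ac xbc] := seq_bounded (x := x) (s := [:: b]) countable_below.
  by move=> y; rewrite /= !inE => /orP[]/eqP->.
have [y Dy cy] := cofD c Ac.
exists y; split=> // [|s [ss sk sx]].
  by apply: lt_le_trans cy; apply: xbc; rewrite mem_head.
have sD : simplex_in m.+1 D s by split=> // z /sx[].
apply: chainsW (proj2 (FP s) sD) => z [Dz zF]; split=> //=.
apply: lt_le_trans cy; apply: lt_trans (xbc b _); last first.
  by rewrite !inE eqxx orbT.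
apply: lt_trans zF _; apply: Fb; split=> // w /sx[Dw wx].
by split=> //; apply: lt_le_trans wx xd.
Qed.

Lemma closed_points_sup P d : D d -> (forall e, P e -> e < d) ->
  (forall x, D x -> (forall e, P e -> e < x) -> d <= x) ->
  (forall e, P e -> exists2 e', P e' & e < e' /\ maps_below e e') ->
  closed_points d.
Proof.
move=> Dd Pd dmin Pnext; split=> // s sd; have [ss sk s_below] := sd.
case: s sk ss s_below sd => // v0 s0 sk ss s_below sd.
have [v vs vmax] := seq_argmax id v0 s0; have [Dv vd] := s_below v vs.
have [e [Pe ve]] : exists e, P e /\ v <= e.
  apply: contrapT => nv; suff : d <= v by rewrite leNgt => /negP.
  apply: dmin => // e Pe; rewrite ltNge; apply/negP => ve.
  by apply: nv; exists e.
have [e' Pe' [ee' _]] := Pnext e Pe; have [e'' Pe'' [_ e'e'']] := Pnext e' Pe'.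
apply: (maps_below_le (lexx e') (ltW (Pd e'' Pe'')) e'e'').
split=> // y ys; split; first by have [] := s_below y ys.
exact: le_lt_trans (vmax y ys) (le_lt_trans ve ee').
Qed.

Lemma closed_points_cofinal : cofinal_in A closed_points.
Proof.
have [DA cofD] := Dcof; split=> [x [/DA]//|x Ax].
have /choice[next nextP] y :
    exists z, A y -> [/\ D z, y < z & maps_below y z].
  have [/maps_below_next[z zP]|nAy] := pselect (A y); first by exists z.
  by exists y => /nAy.
pose u k := iter k next x.
have uA k : A (u k) by elim: k => //= k /nextP[/DA].
have [b Ab ub] := countable_below uA; have [y Dy ley] := cofD b Ab.
have [|d [Dd ud] dmin] :=
    well_ordered_min gamma_wf (P := [set d | D d /\ forall k, u k < d]).
  by exists y; split=> // k; apply: lt_le_trans (ub k _) ley.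
exists d; last exact: ltW (ud 0%N).
apply: (@closed_points_sup (range u)) => // [_ [k _ <-] //|z Dz uz|_ [k _ <-]].
  by apply: dmin; split=> // k; apply: uz; exists k.
exists (u k.+1); first by exists k.+1.
by have [_] := nextP _ (uA k).
Qed.

Lemma below_closed_points d :
  empty_or_max (below closed_points d) \/
  cofinal_in (below D d) (below closed_points d).
Proof.
set E := below closed_points d.
have [|nmax] := pselect (exists2 b, E b & forall x, E x -> x <= b).
  by left; right.
right; split=> [x [[Dx _] xd] //|x [Dx xd]].
apply: contrapT => nx.
have Ex e : E e -> e < x.
  by move=> Ee; rewrite ltNge; apply/negP => xe; apply: nx; exists e.
have [|d' [Dd' Ed'] d'min] :=
    well_ordered_min gamma_wf (P := [set d' | D d' /\ forall e, E e -> e < d']).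
  by exists x.
have d'd : d' < d by apply: le_lt_trans xd; apply: d'min.
suff d'closed : closed_points d'.
  by have := Ed' d' (conj d'closed d'd); rewrite ltxx.
apply: (@closed_points_sup E) => // [y Dy Ey|e Ee]; first exact: d'min.
have [e' Ee' ee'] : exists2 e', E e' & e < e'.
  apply: contrapT => ne; apply: nmax; exists e => // y Ey.
  by rewrite leNgt; apply/negP => ey; apply: ne; exists y.
exists e' => //; split=> //; have [[_ e'closed] _] := Ee'.
exact: maps_below_le (ltW ee') (lexx e') e'closed.
Qed.

End ClosedPoints.

Lemma splits_acyclic_on (disp : Order.disp_t) (gamma : orderType disp) m
    (A : set gamma) :
  well_ordered gamma -> splits m A -> acyclic_on m A.
Proof.
move=> gamma_wf; elim: m A => [|m IH] A Asplits.
  exact: splits0_acyclic_on.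
have [countable_below|/cofinal_omega[D Dcof Dbelow]] :=
  pselect (below_cof [set: nat] A).
  have [D Dcof Dreg] := cofinal_regular A gamma_wf.
  have [f fP] := splits_cofinal Dcof Asplits; have fD := splitting_chains fP.
  apply: (acyclic_on_cofinal gamma_wf
    (closed_points_cofinal gamma_wf Dcof Dreg countable_below fD)) => d.
  move=> [Dd d_closed].
  have [|Ecof] := below_closed_points D m.+1 f gamma_wf d.
    exact: acyclic_on_empty_or_max.
  apply/IH/(splits_cofinal Ecof)/(splits_below fP Dd) => c.
  exact: supported_linear.
apply: (acyclic_on_cofinal gamma_wf Dcof) => d /Dbelow.
exact: acyclic_on_empty_or_max.
Qed.

(** * Simplices as sorted sequences *)

Section SimplexChains.
Context (disp : Order.disp_t) (gamma : orderType disp).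
Implicit Types (s : seq gamma) (A : set gamma) (m : nat).

Definition vertex_seq m (sx : simplex gamma m) : seq gamma := tval (val sx).

Definition simplex_of m s : option (simplex gamma m) :=
  obind (fun u : m.-tuple gamma => insub u) (insub s).

Lemma vertex_seqK m : pcancel (@vertex_seq m) (simplex_of m).
Proof. by move=> sx; rewrite /simplex_of /vertex_seq valK /= valK. Qed.

Lemma simplex_ofK m : ocancel (simplex_of m) (@vertex_seq m).
Proof.
move=> s; rewrite /simplex_of; case: insubP => //= u _ <-.
by case: insubP => //= sx _ <-.
Qed.

Lemma simplex_in_vertex_seq m A (sx : simplex gamma m) :
  simplex_in m A (vertex_seq sx) <-> [set` vertex_seq sx] `<=` A.
Proof.
by split=> [[]|] //; split=> //; [apply: (valP sx) | apply: size_tuple].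
Qed.

Lemma simplex_in_simplex m A s :
  simplex_in m A s -> exists sx : simplex gamma m, vertex_seq sx = s.
Proof.
case=> ss sm _.
pose t := Tuple (introT eqP sm).
by exists (exist (fun t : m.-tuple gamma => sorted <%O t) t ss).
Qed.

HB.instance Definition _ m :=
  GRing.isScalable.Build int (chain gamma m.+1) (chain gamma m) _
    (@bd _ gamma m) (raddf_int_scalable _).

Definition to_seqchain m : chain gamma m -> seqchain gamma :=
  freeg_map (@vertex_seq m).

HB.instance Definition _ m := GRing.Linear.on (@to_seqchain m).

Definition of_seqchain m : seqchain gamma -> chain gamma m :=
  freeg_pmap (simplex_of m).

HB.instance Definition _ m := GRing.Linear.on (@of_seqchain m).

Lemma to_seqchainU m (sx : simplex gamma m) :
  to_seqchain << sx >> = << vertex_seq sx >>.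
Proof. exact: freeg_mapU. Qed.

Lemma to_seqchainK m : cancel (@to_seqchain m) (@of_seqchain m).
Proof. exact: freeg_mapK (@vertex_seqK m). Qed.

Lemma of_seqchainK m A c : chains m A c -> to_seqchain (of_seqchain m c) = c.
Proof.
move=> cA; apply: (freeg_pmapK (@simplex_ofK m)).
by apply: supportedW cA => _ /simplex_in_simplex[sx <-] /=; rewrite vertex_seqK.
Qed.

Lemma boundary_seqE s : boundary << s >> =
  \sum_(i < size s) (-1) ^+ i *: << take i s ++ drop i.+1 s >>.
Proof.
rewrite contractU; elim: s => [|x s IH] /=; first by rewrite big_ord0.
rewrite big_ord_recl /= drop0 expr0 IH raddf_sum -sumrN /=; congr (_ + _).
by apply: eq_bigr => i _; rewrite linearZ /= freeg_mapU exprS mulN1r scaleNr.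
Qed.

Lemma vertex_seq_del m (sx : simplex gamma m.+1) i :
  vertex_seq (del sx i) = take i (vertex_seq sx) ++ drop i.+1 (vertex_seq sx).
Proof.
rewrite /vertex_seq; have x0 : gamma := tnth (val sx) ord0.
have im := ltn_ord i; rewrite ltnS in im.
have size_take_i : size (take i (val sx)) = i.
  by rewrite size_takel // size_tuple leqW.
apply: (@eq_from_nth _ x0).
  by rewrite size_tuple size_cat size_take_i size_drop size_tuple subSS subnKC.
move=> j; rewrite size_tuple => jm.
rewrite -[j]/(val (Ordinal jm)) -tnth_nth tnth_map tnth_ord_tuple.
rewrite (tnth_nth x0) nth_cat size_take_i /= /bump.
case: ltnP => ji; first by rewrite nth_take // add0n.
by rewrite nth_drop add1n addSn subnKC.
Qed.

Lemma to_seqchain_bd m (c : chain gamma m.+1) :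
  to_seqchain (bd c) = boundary (to_seqchain c).
Proof.
apply: (eq_linear (f := @to_seqchain m \o @bd _ gamma m)
  (g := boundary \o @to_seqchain m.+1)) => sx /=.
rewrite to_seqchainU boundary_seqE size_tuple /bd fgliftU raddf_sum /=.
apply: eq_bigr => i _.
by rewrite freegU_scale linearZ /= to_seqchainU vertex_seq_del.
Qed.

Lemma bd_bd m (c : chain gamma m.+2) : bd (bd c) = 0.
Proof.
by apply: (can_inj (@to_seqchainK m)); rewrite !to_seqchain_bd contractK raddf0.
Qed.

Lemma bd_of_seqchain m A c : chains m.+1 A c ->
  bd (of_seqchain m.+1 c) = of_seqchain m (boundary c).
Proof.
move=> cA; apply: (can_inj (@to_seqchainK m)).
by rewrite to_seqchain_bd !(@of_seqchainK _ A) //; apply: chains_contract.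
Qed.

Definition simplices_in m A : set (simplex gamma m) :=
  [set sx | [set` vertex_seq sx] `<=` A].

Lemma chains_to_seqchain m A (c : chain gamma m) :
  supported (simplices_in A) c -> chains m A (to_seqchain c).
Proof. by apply: supported_map => sx /simplex_in_vertex_seq. Qed.

Lemma supported_of_seqchain m (P : set (seq gamma)) c :
  supported P c -> supported (@vertex_seq m @^-1` P) (of_seqchain m c).
Proof.
apply: supported_pmap => s sx sxE Ps; have := @simplex_ofK m s.
by rewrite sxE /= => sxs; rewrite /= sxs.
Qed.

Lemma supported_bd m A (c : chain gamma m.+1) :
  supported (simplices_in A) c -> supported (simplices_in A) (bd c).
Proof.
move=> /chains_to_seqchain cA; rewrite -[bd c]to_seqchainK to_seqchain_bd.
apply: supportedW (supported_of_seqchain (chains_contract cA)) => sx.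
by move=> /simplex_in_vertex_seq.
Qed.

Lemma sort_fset s : sorted <%O s -> sort <=%O [fset x in s]%fset = s.
Proof.
move=> ss; apply: (le_sorted_eq (sort_le_sorted _)).
  by apply: sub_sorted ss => x y; apply: ltW.
rewrite perm_sort; apply: uniq_perm; first exact: fset_uniq.
  exact: sorted_uniq lt_trans ltxx _ ss.
by move=> x; rewrite !inE.
Qed.

Lemma sort_vertices m (sx : simplex gamma m) :
  sort <=%O (vertices sx) = vertex_seq sx.
Proof. exact: sort_fset (valP sx). Qed.

Lemma card_vertices m (sx : simplex gamma m) : #|` vertices sx| = m.
Proof. by rewrite -(size_sort <=%O) sort_vertices size_tuple. Qed.

Lemma fset_vertices m (s : {fset gamma}) :
  #|` s| = m -> exists sx : simplex gamma m, vertices sx = s.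
Proof.
move=> sm; have ss : sorted <%O (sort <=%O s).
  by rewrite lt_sorted_uniq_le sort_uniq fset_uniq sort_le_sorted.
have [|sx sxs] := @simplex_in_simplex m setT (sort <=%O s).
  by split=> //; rewrite size_sort.
exists sx; apply/fsetP => x.
by rewrite inE -[tval _]/(vertex_seq sx) sxs mem_sort.
Qed.

Definition vmin m (sx : simplex gamma m.+1) : gamma := tnth (val sx) ord0.

Lemma mem_vmin m (sx : simplex gamma m.+1) : vmin sx \in vertex_seq sx.
Proof. exact: mem_tnth. Qed.

Lemma vmin_le m (sx : simplex gamma m.+1) x :
  x \in vertex_seq sx -> vmin sx <= x.
Proof.
have sxT : simplex_in m.+1 setT (vertex_seq sx) by apply/simplex_in_vertex_seq.
rewrite /vmin (tnth_nth x) -[tval _]/(vertex_seq sx).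
by case: vertex_seq sxT => [[]//|y s /simplex_in_tail[_ _ ys]] /ys[].
Qed.

End SimplexChains.

(** * Bases of the system of boundaries *)

Section BoundaryBases.
Context (disp : Order.disp_t) (gamma : orderType disp) (n : nat).
Local Notation point := {b : gamma & term (dP gamma n) b}.
Implicit Types (a : gamma) (B : set point) (c : {freeg point / int}).

Definition eval_points : {freeg point / int} -> chain gamma n :=
  fglift (fun p : point => val (tagged p : dP_term n (tag p))).

HB.instance Definition _ := GRing.Linear.on eval_points.

Lemma eval_pointsU (p : point) :
  eval_points << p >> = val (tagged p : dP_term n (tag p)).
Proof. exact: fgliftU. Qed.

Definition basis_of_boundaries B : Prop :=
  (forall a z, z \in dP_pred (n := n) a ->
     exists2 c, supported (B `&` [set p | a <= tag p]) c & eval_points c = z) /\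
  (forall c, supported B c -> eval_points c = 0 -> c = 0).

Lemma eval_points_val a (f : {freeg (above (dP gamma n) a) / int}) :
  eval_points (freeg_map val f) =
  val (\sum_(p <- dom f) bond_above p *~ coeff p f : dP_term n a).
Proof.
rewrite raddf_sum /= -{1}[f]freeg_sumE !raddf_sum /=; apply: eq_bigr => p _.
rewrite -[X in << X *g _ >>]intz -freegU_mulz !raddfMz /=.
rewrite freeg_mapU eval_pointsU.
exact/esym/(raddfMz (val : dP_term n a -> chain gamma n)).
Qed.

Lemma decompositionP (B : forall b, term (dP gamma n) b -> Prop) a
    (x : term (dP gamma n) a) f :
  decomposition B x f <->
  supported [set p | B (tag p) (tagged p)] (freeg_map val f) /\
  eval_points (freeg_map val f) = val (x : dP_term n a).
Proof.
split=> [[fB ->]|[fB fx]].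
  by rewrite -eval_points_val; split=> //; apply: supported_map fB.
split; last by apply: val_inj; rewrite -fx eval_points_val.
rewrite -[f](freeg_mapK (f := val) valK); apply: supported_pmap fB => p q.
by case: insubP => //= u _ <- [->].
Qed.

Lemma freeg_map_val_above a c : supported [set p : point | a <= tag p] c ->
  exists f : {freeg (above (dP gamma n) a) / int}, freeg_map val f = c.
Proof.
move=> ca; exists (freeg_pmap insub c).
apply: freeg_pmapK; first exact: insubK.
by apply: supportedW ca => p ap /=; rewrite insubT.
Qed.

Lemma free_system_basis : well_ordered gamma ->
  free_system (dP gamma n) -> exists B, basis_of_boundaries B.
Proof.
move=> gamma_wf [B BP].
exists [set p | B (tag p) (tagged p)]; split=> [a z za|c cB c0].
  have [f [/decompositionP[fB fz] _]] := BP a (exist _ z za : dP_term n a).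
  exists (freeg_map val f) => //; apply: supportedI fB _.
  by apply: (@supported_map _ _ _ _ setT) => // p _; apply: (valP p).
have [//|/freeg_neq0[p _]] := pselect (c = 0).
have [|a _ amin] := well_ordered_min gamma_wf (P := setT).
  by exists (tag p).
have [|f fc] := @freeg_map_val_above a c; first by move=> q _; apply: amin.
have [f0 [_ f0_uniq]] := BP a 0; rewrite -fc.
rewrite -(f0_uniq f) ?(f0_uniq 0) ?raddf0 //; apply/decompositionP.
  by rewrite !raddf0; split=> //; apply: supported0.
by rewrite fc.
Qed.

Lemma basis_free_system B :
  basis_of_boundaries B -> free_system (dP gamma n).
Proof.
move=> [Bspan Bind].
exists (fun b x => B (Tagged (term (dP gamma n)) x)) => a x.
have taggedB (c : {freeg point / int}) : supported B c <->
    supported [set p | B (Tagged (term (dP gamma n)) (tagged p))] c.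
  by split; apply: supportedW => -[].
have [c cB cx] := Bspan a (val (x : dP_term n a)) (valP _).
have [|f fc] := @freeg_map_val_above a c; first by apply: supportedW cB => p [].
exists f; split=> [|g /decompositionP[/taggedB gB gx]].
  apply/decompositionP; rewrite fc; split=> //; apply/taggedB.
  by apply: supportedW cB => p [].
apply: (can_inj (freeg_mapK (f := val) valK)); apply/eqP; rewrite -subr_eq0.
apply/eqP/Bind; last by rewrite raddfB /= fc cx gx subrr.
by apply: supportedB => //; rewrite fc; apply: supportedW cB => p [].
Qed.

End BoundaryBases.

Section BasesAndSplittings.
Context (disp : Order.disp_t) (gamma : orderType disp) (n : nat).
Local Notation point := {b : gamma & term (dP gamma n) b}.
Implicit Types (a : gamma) (B : set point) (sx : simplex gamma n.+1).

Lemma bd_dP_pred sx : bd << sx >> \in dP_pred (n := n) (vmin sx).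
Proof.
apply/asboolP; exists << sx >> => //.
apply: (@supportedU _ _ [set sy | {subset tval (val sy) <= tail (vmin sx)}]).
exact: vmin_le.
Qed.

Lemma boundary_expansion B : basis_of_boundaries B ->
  exists h : {linear chain gamma n.+1 -> {freeg point / int}},
    [/\ forall c, eval_points (h c) = bd c, forall c, supported B (h c) &
      forall a c, supported (simplices_in (tail_of setT a)) c ->
        supported [set p | a <= tag p] (h c)].
Proof.
move=> [Bspan _]; have /choice[h hP] sx : exists c : {freeg point / int},
    supported (B `&` [set p | vmin sx <= tag p]) c /\
    eval_points c = bd << sx >>.
  by have [c cB cE] := Bspan (vmin sx) _ (bd_dP_pred sx); exists c.
exists (fglift h : {linear _ -> _}); split=> [c|c|a c].
- apply: (eq_linear (f := @eval_points _ gamma n \o fglift h)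
    (g := @bd _ gamma n)) => sx.
  by rewrite /= fgliftU (proj2 (hP sx)).
- apply: (@supported_lift _ _ _ setT) => // sx _.
  by apply: supportedW (proj1 (hP sx)) => p [].
apply: supported_lift => sx sxa.
apply: supportedW (proj1 (hP sx)) => p [_]; apply: le_trans.
by have [] := sxa _ (mem_vmin sx).
Qed.

Lemma boundary_filling :
  exists h : {linear {freeg point / int} -> chain gamma n.+1},
    (forall c, bd (h c) = eval_points c) /\
    forall a c, supported [set p | a <= tag p] c ->
      supported (simplices_in (tail_of setT a)) (h c).
Proof.
have /choice[h hP] (p : point) : exists c : chain gamma n.+1,
    supported (simplices_in (tail_of setT (tag p))) c /\
    bd c = eval_points << p >>.
  case: p => b [z zb]; have /asboolP[c cb zE] := zb.
  exists c; rewrite eval_pointsU /= zE; split=> // s /cb sb x /sb bx.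
  by split.
exists (fglift h : {linear _ -> _}); split=> [c|a c].
  apply: (eq_linear (f := @bd _ gamma n \o fglift h)
    (g := @eval_points _ gamma n)) => p.
  by rewrite /= fgliftU (proj2 (hP p)).
apply: supported_lift => p ap; apply: supportedW (proj1 (hP p)) => sx sxp x.
by move=> /sxp[_ px]; split=> //; apply: le_trans px.
Qed.

Lemma basis_splits B : basis_of_boundaries B -> splits n [set: gamma].
Proof.
move=> Bbasis; have [_ Bind] := Bbasis.
have [expand [eval_expand expandB expand_tail]] := boundary_expansion Bbasis.
have [fill [bd_fill fill_tail]] := boundary_filling.
exists (@to_seqchain _ gamma n.+1 \o fill \o expand
  \o @of_seqchain _ gamma n.+1 : {linear _ -> _}).
split=> [a c cA|c cA|c cA dc] /=.
- apply: chains_to_seqchain; apply: fill_tail; apply: expand_tail.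
  by apply: supportedW (supported_of_seqchain cA) => sx /simplex_in_vertex_seq.
- rewrite -to_seqchain_bd bd_fill eval_expand to_seqchain_bd.
  by rewrite (of_seqchainK cA).
suff -> : expand (of_seqchain n.+1 c) = 0 by rewrite !raddf0.
apply: Bind => //.
by rewrite eval_expand (bd_of_seqchain cA) dc raddf0.
Qed.

Definition boundary_point sx : point :=
  Tagged (term (dP gamma n))
    (exist _ (bd << sx >>) (bd_dP_pred sx) : dP_term n (vmin sx)).

Lemma eval_boundary_points (c : chain gamma n.+1) :
  eval_points (freeg_map boundary_point c) = bd c.
Proof.
apply: (eq_linear (f := @eval_points _ gamma n \o freeg_map boundary_point)
  (g := @bd _ gamma n)) => sx.
by rewrite /= freeg_mapU eval_pointsU.
Qed.

Lemma boundary_points_basis (S : set (simplex gamma n.+1)) :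
  (forall a z, z \in dP_pred (n := n) a ->
     exists2 c, supported (S `&` simplices_in [set x | a <= x]) c & bd c = z) ->
  (forall c, supported S c -> bd c = 0 -> c = 0) ->
  basis_of_boundaries (boundary_point @` S).
Proof.
move=> Sspan Sind; split=> [a z /Sspan[c cS cz]|_ /supported_image[c cS <-]].
  exists (freeg_map boundary_point c); last by rewrite eval_boundary_points.
  apply: supported_map cS => sx [Ssx sxa]; split; first by exists sx.
  exact: sxa (mem_vmin sx).
by rewrite eval_boundary_points => /(Sind c cS)->; rewrite raddf0.
Qed.

End BasesAndSplittings.

Section TailAcyclicComplexes.
Context (disp : Order.disp_t) (gamma : orderType disp) (n : nat).
Context (G : {fset gamma} -> Prop).
Hypothesis G_dim : n_dimensional G n.
Hypothesis G_acyclic : tail_acyclic G n.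

Lemma tail_acyclic_independent (c : chain gamma n.+1) : well_ordered gamma ->
  chain_in G c -> bd c = 0 -> c = 0.
Proof.
move=> gamma_wf cG dc; have [//|/freeg_neq0[sx _]] := pselect (c = 0).
have [|a _ amin] := well_ordered_min gamma_wf (P := setT).
  by exists (vmin sx).
have [_ /(_ a n)/(_ c)[|//|e eG <-]] := G_acyclic.
  by move=> sy /cG Gsy; split=> // x _; apply: amin.
suff -> : e = 0 by rewrite raddf0.
apply: supported_set0 => sy /eG[Gsy _].
have [/(_ n.+1 (vertices sy)) dimG _] := G_dim.
by have := dimG (conj Gsy (card_vertices sy)); rewrite ltnn.
Qed.

Lemma tail_acyclic_spanning a (z : chain gamma n) : (0 < n)%N ->
  z \in dP_pred (n := n) a ->
  exists2 c : chain gamma n.+1, chain_in (restrict G (tail a)) c & bd c = z.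
Proof.
have [] := G_acyclic.
case: (n) z => // k z G_full G_homology _ /asboolP[c ca zE].
apply: G_homology; last by rewrite zE bd_bd.
rewrite zE; apply: supportedW (supported_bd (A := [set x | a <= x]) ca).
move=> sx sxa; split; last by move=> x; rewrite inE => /sxa.
by have [_ /(_ (card_vertices sx))[]] := G_full (vertices sx).
Qed.

Lemma tail_acyclic_basis : (0 < n)%N -> well_ordered gamma ->
  basis_of_boundaries
    (@boundary_point _ gamma n @` [set sx | G (vertices sx)]).
Proof.
move=> n_gt0 gamma_wf.
apply: boundary_points_basis => [a z za|c]; last first.
  exact: tail_acyclic_independent.
have [c cG <-] := tail_acyclic_spanning n_gt0 za; exists c => //.
apply: supportedW cG => sx [Gsx sxa]; split=> // x xs.
by apply: sxa; rewrite inE.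
Qed.

End TailAcyclicComplexes.

(** * The complex of an acyclic set of simplices *)

Section AcyclicComplex.
Context (disp : Order.disp_t) (gamma : orderType disp) (n : nat).
Context (S : set (seq gamma)).
Implicit Types (a : gamma).

Definition complex_of (s : {fset gamma}) : Prop :=
  s != fset0%fset /\
  ((#|` s| <= n)%N \/ #|` s| = n.+1 /\ S (sort <=%O s)).

Lemma complex_of_vertices m (sx : simplex gamma m) :
  complex_of (vertices sx) <->
  (0 < m)%N /\ ((m <= n)%N \/ m = n.+1 /\ S (vertex_seq sx)).
Proof.
by rewrite /complex_of -cardfs_gt0 card_vertices sort_vertices.
Qed.

Lemma complex_of_simplicial : simplicial_complex complex_of.
Proof.
split=> [s []//|s t [_ Gs] ts t0]; split=> //.
have [tn|nt] := leqP #|` t| n; [by left | right].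
case: Gs => [sn|[sn Ss]].
  by have := leq_trans (fsubset_leq_card ts) sn; rewrite leqNgt nt.
suff -> : t = s by [].
by apply/eqP; rewrite eqEfcard ts sn.
Qed.

Lemma complex_of_dimensional :
  acyclic_faces S n setT -> n_dimensional complex_of n.
Proof.
move=> [S_span _]; split=> [k s [[_ Gs] sk]|[f /fset_vertices[sx _]]].
  by case: Gs; rewrite sk; [apply: ltnW | case=> -[->]].
have sx_tail : simplex_in n.+1 (tail_of setT (vmin sx)) (vertex_seq sx).
  by apply/simplex_in_vertex_seq => x /vmin_le.
have [c [cA cS dc]] := S_span _ _ (supportedU sx_tail).
have [c0|/freeg_neq0[u uc]] := pselect (c = 0).
  by have := boundary_simplex_neq0 sx_tail; rewrite -dc c0 raddf0.
have [sy uE] := simplex_in_simplex (cA u uc).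
exists (vertices sy); split; last exact: card_vertices.
apply/complex_of_vertices; split=> //; right; rewrite uE.
by split; last exact: cS.
Qed.

Lemma chains_of_restrict a k (z : chain gamma k.+1) :
  chain_in (restrict complex_of (tail a)) z ->
  chains k.+1 (tail_of setT a) (to_seqchain z).
Proof.
move=> zG; apply: chains_to_seqchain; apply: supportedW zG => sx [_ sxa] x xs.
by split=> //; apply: sxa; rewrite inE.
Qed.

Lemma restrict_of_chains a k c : chains k.+1 (tail_of setT a) c ->
  (k < n)%N \/ k = n /\ supported S c ->
  chain_in (restrict complex_of (tail a)) (of_seqchain k.+1 c).
Proof.
move=> cA kS.
have cP : supported [set s | (k < n)%N \/ k = n /\ S s] c.
  by case: kS => [kn|[kn cS]] s sc; [left | right; split=> //; apply: cS].
apply: supportedW (supported_of_seqchain (supportedI cA cP)) => sx.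
move=> [/simplex_in_vertex_seq sxa kSx]; split.
  apply/complex_of_vertices; split=> //.
  by case: kSx => [|[kn Ssx]]; [left | right; split=> //; rewrite kn].
by move=> x; rewrite inE => /sxa[].
Qed.

Lemma complex_of_cycle_eq0 a k (z : chain gamma k.+1) :
  independent S n setT -> (n <= k)%N ->
  chain_in (restrict complex_of (tail a)) z -> bd z = 0 -> z = 0.
Proof.
move=> S_ind nk zG z0; apply: (can_inj (@to_seqchainK _ _ _)); rewrite raddf0.
have zS : supported [set s | k = n /\ S s] (to_seqchain z).
  apply: supported_map zG => sx [/complex_of_vertices[_ +] _].
  by case=> [|[[]]//]; rewrite ltnNge nk.
have [kn|kn] := eqVneq k n; last first.
  by apply: supported_set0 => s /zS[/eqP]; rewrite (negbTE kn).
subst k; apply: S_ind.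
- by apply: chainsW (chains_of_restrict zG).
- by apply: supportedW zS => s [].
- by rewrite -to_seqchain_bd z0 raddf0.
Qed.

Lemma complex_of_tail_acyclic : (0 < n)%N ->
  acyclic_faces S n setT -> tail_acyclic complex_of n.
Proof.
move=> n_gt0 [S_span S_ind]; split=> [s|a k z zG z0].
  rewrite /face prednK //; split=> [[]//|sn]; split=> //.
  by split; [rewrite -cardfs_gt0 sn | left; rewrite sn].
have [nk|kn] := leqP n k.
  rewrite (complex_of_cycle_eq0 S_ind nk zG z0).
  by exists 0; [apply: supported0 | rewrite raddf0].
have zA := chains_of_restrict zG.
have cA : chains k.+2 (tail_of setT a) (cone a (to_seqchain z)).
  by apply: chains_cone zA; split=> /=.
have [c [c_chain c_top dc]] : exists c, [/\ chains k.+2 (tail_of setT a) c,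
    (k.+1 < n)%N \/ k.+1 = n /\ supported S c & boundary c = to_seqchain z].
  have dcone : boundary (cone a (to_seqchain z)) = to_seqchain z.
    by apply: boundary_cone_cycle zA _; rewrite -to_seqchain_bd z0 raddf0.
  move: kn; rewrite leq_eqVlt => /orP[/eqP kn|kn]; last first.
    by exists (cone a (to_seqchain z)); split=> //; left.
  have := S_span a; rewrite -kn => /(_ _ cA)[c [cA' cS dc]].
  by exists c; split; [|right|rewrite dc].
exists (of_seqchain k.+2 c); first exact: restrict_of_chains.
by rewrite (bd_of_seqchain c_chain) dc to_seqchainK.
Qed.

End AcyclicComplex.

Theorem theorem3p7 (n : nat) (disp : Order.disp_t) (gamma : orderType disp)
    (hn : (1 <= n)%N) (hgamma : well_ordered gamma) :
  free_system (dP gamma n) <->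
  exists G : {fset gamma} -> Prop,
    [/\ simplicial_complex G, n_dimensional G n & tail_acyclic G n].
Proof.
split=> [/(free_system_basis hgamma)[B Bbasis]|[G [_ G_dim G_acyclic]]].
  have [S S_acyclic] := splits_acyclic_on hgamma (basis_splits Bbasis).
  exists (complex_of n S); split.
  - exact: complex_of_simplicial.
  - exact: complex_of_dimensional.
  - exact: complex_of_tail_acyclic.
apply: basis_free_system.
exact: tail_acyclic_basis G_dim G_acyclic hn hgamma.
Qed.
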